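(* Let $d\ge2$, let $\varepsilon>0$, let $B\subset\mathbb{R}^d$ be a ball, and let $\{D_m\}_{m=0}^\infty$ be a sequence of domains in $\mathcal{O}_{\varepsilon,B}$ that converges to a domain $D'\in\mathcal{O}_{\varepsilon,B}$ with respect to the Hausdorff metric, i.e. $d_{\mathcal H}(D_m,D')\to0$. Suppose there exists a sequence $\{x_m\}_{m=0}^\infty$ such that $x_m\in D_m$ for every $m\ge0$ and $x_m\to x'$ for some $x'\in D'$. Let $\tau_{D_m}$ and $\tau_{D'}$ denote the first exit times of Brownian motion from $D_m$ and $D'$, respectively. Then for every $t>0$, $$\lim_{m\to\infty}\mathbb{P}_{x_m}(\tau_{D_m}>t)=\mathbb{P}_{x'}(\tau_{D'}>t).$$
   Context: A domain is an open connected subset of $\mathbb{R}^d$ with nonempty boundary. Brownian motion in $\mathbb{R}^d$ has transition density $p(t,x,y)=(2\pi t)^{-d/2}e^{-|x-y|^2/2t}$; $\mathbb{P}_x$ is its law when started at $x$, and $\tau_D$ is the first exit time from $D$. For $y\in\mathbb{R}^d$, a unit vector $\xi\in\mathbb{R}^d$ and $\varepsilon>0$, let $C(y,\xi,\varepsilon)=\{z\in\mathbb{R}^d:\langle z-y,\xi\rangle\ge\cos(\varepsilon)|z-y|\text{ and }0<|z-y|<\varepsilon\}$. An open set $D$ has the $\varepsilon$-cone property if for every $x\in\partial D$ there is a unit vector $\xi_x$ such that $C(y,\xi_x,\varepsilon)\subset D$ for every $y\in\overline{D}\cap B(x,\varepsilon)$. For a ball $B$, $\mathcal{O}_{\varepsilon,B}$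 is the class of domains $D\subset B$ having the $\varepsilon$-cone property. The Hausdorff distance between bounded domains is $d_{\mathcal H}(D_1,D_2)=\max\{\sup_{x\in D_1}d(x,D_2),\ \sup_{x\in D_2}d(x,D_1)\}$.
   Formalization: The formal theorem also assumes cos ε ≠ 1, i.e. ε is not a multiple of 2π; for such ε the cone C(y,ξ,ε) degenerates to a segment, and domains with ever denser thin inward spikes show that the claim fails as stated. *)

(* Defs.v *)
From HB Require Import structures.
From mathcomp Require Import all_boot all_order all_algebra.
From mathcomp Require Import all_classical all_reals all_analysis.

Set Implicit Arguments.
Unset Strict Implicit.
Unset Printing Implicit Defensive.

Import Order.TTheory GRing.Theory Num.Theory.
Import numFieldNormedType.Exports.

Local Open Scope classical_set_scope.
Local Open Scope ring_scope.

(* The library norm on 'rV[R]_d is the sup norm, so the Euclidean norm is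
   introduced here; both induce the library topology, which is the one used
   below for open, connected, closure and limits. *)
Section euclidean.
Context {R : realType} {d : nat}.
Implicit Types x y z xi : 'rV[R]_d.

Definition edot x y : R := \sum_(i < d) x 0 i * y 0 i.

Definition enorm x : R := Num.sqrt (edot x x).

Definition eball x (r : R) : set 'rV[R]_d := [set y | enorm (y - x) < r].

End euclidean.

Section domains.
Context {R : realType} {d : nat}.
Implicit Types (D : set 'rV[R]_d) (x y xi : 'rV[R]_d) (eps : R).

Definition boundary D : set 'rV[R]_d := closure D `\` D°.

Definition is_domain D : Prop := [/\ open D, connected D & boundary D !=set0].

(* When cos eps = 1 the angular condition forces z - y to be a nonnegative
   multiple of xi, so this degenerates to a segment. *)
Definition cone y xi eps : set 'rV[R]_d :=
  [set z | cos eps * enorm (z - y) <= edot (z - y) xi /\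
           0 < enorm (z - y) < eps].

Definition cone_property eps D : Prop :=
  forall x, boundary D x -> exists xi, enorm xi = 1 /\
    forall y, (closure D `&` eball x eps) y -> cone y xi eps `<=` D.

Definition cone_class eps (B : set 'rV[R]_d) : set (set 'rV[R]_d) :=
  [set D | [/\ is_domain D, D `<=` B & cone_property eps D]].

Definition edist x D : \bar R :=
  ereal_inf [set (enorm (x - y))%:E | y in D].

Definition hausdorff_dist (D1 D2 : set 'rV[R]_d) : \bar R :=
  maxe (ereal_sup [set edist x D2 | x in D1])
       (ereal_sup [set edist x D1 | x in D2]).

End domains.

Section brownian.
Context {R : realType} {d : nat}.

(* The last condition says that the increments over successive intervals are
   independent and that the one over [s, s'] has d independent coordinates
   with law N(0, s' - s) (the second parameter of normal_prob is the standard
   deviation).  The product of these d densities is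
   y |-> (2 pi (s' - s))^(-d/2) exp(- |y|^2 / (2 (s' - s))), so that x + y has
   density p(s' - s, x, x + y). *)
Definition is_brownian (dsp : measure_display) (Omega : measurableType dsp)
    (P : probability Omega R) (X : R -> Omega -> 'rV[R]_d) (x : 'rV[R]_d) :=
  [/\ forall (t : R) (i : 'I_d), 0 <= t ->
        measurable_fun [set: Omega] (fun w => X t w 0 i),
      forall w, {within `[0, +oo[, continuous (fun t => X t w)},
      P [set w | X 0 w = x] = 1%E
    & forall (n : nat) (t : nat -> R) (A : 'I_n -> 'I_d -> set R),
        0 <= t 0%N -> (forall k, t k < t k.+1) ->
        (forall k i, measurable (A k i)) ->
        P [set w | forall (k : 'I_n) (i : 'I_d),
                     A k i ((X (t k.+1) w - X (t k) w) 0 i)] =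
        (\prod_(k < n) \prod_(i < d)
           normal_prob 0 (Num.sqrt (t k.+1 - t k)) (A k i))%E].

(* P x plays the role of the law of Brownian motion started at x, for the
   single process X, as usual for Markov processes. *)
Definition brownian_family (dsp : measure_display) (Omega : measurableType dsp)
    (P : 'rV[R]_d -> probability Omega R) (X : R -> Omega -> 'rV[R]_d) :=
  forall x, is_brownian (P x) X x.

(* Equal to +oo when the path never leaves D. *)
Definition exit_time (path : R -> 'rV[R]_d) (D : set 'rV[R]_d) : \bar R :=
  ereal_inf [set s%:E | s in [set s : R | 0 <= s /\ ~ D (path s)]].

End brownian.

(* Main.v *)
Require Import Defs.
From HB Require Import structures.
From mathcomp Require Import all_boot all_order all_algebra.
From mathcomp Require Import all_classical all_reals all_analysis.
From mathcomp Require Import measurable_realfun.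
From mathcomp Require Import ring lra.

Set Implicit Arguments.
Unset Strict Implicit.
Unset Printing Implicit Defensive.

Import Order.TTheory GRing.Theory Num.Theory.
Import numFieldNormedType.Exports.

Local Open Scope classical_set_scope.
Local Open Scope ring_scope.

(** The survival event is the event that the path stays in the domain during
    [[0, t]].  Since the law of the increments does not depend on the starting
    point, the path started at [x m] may be replaced by the path started at
    [x'] and translated by [b = x m - x'], which tends to [0]
    ([stays_translate]).  Two deterministic inclusions then squeeze the
    probabilities.

    - From below, a path that stays in [D'] stays at some distance [rho] from
      the complement of [D'], by compactness ([stays_open_exhaust]).  The part
      of [D'] at distance at least [rho / 2] from the complement is contained
      in [D m] for large [m] ([cone_property_fills]): Hausdorff convergence
      alone would allow small holes in [D m], but at a hole there would be a
      boundary point [x0] with a cone direction [xi], and [D m] has points so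
      close to [x0 - s *: xi] that their cones contain [x0].
    - From above, [D m] lies in a small neighbourhood of [D'], so in the limit
      the translated path stays in the closure of [D'].

    It remains to see that a path that stays in the closure of [D'] almost
    surely does not touch the boundary of [D'] ([boundary_not_touched]).
    Near a boundary point, translating the closure of [D'] by [h *: xi], with
    [h > 0] small, brings it into [D'] ([cone_property_shift]).  Consider the event [G] that during a time interval [[s, u]], with [s > 0],
    the path stays in the closure of [D'], near that boundary point, and
    leaves [D'].  If the path translated by [h1 *: xi] is in [G] then the one
    translated by [h2 *: xi], with [h1 < h2], stays in [D'] and is not in [G].
    So the events that the translated path is in [G] are disjoint for
    different [h], and their probabilities cannot all exceed a given positive
    number ([exits_within_null]).  On the other hand a translation changes the
    law of the position at time [s] from a normal law to an equivalent one,
    with a density bounded below on bounded sets, and leaves the increments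
    after [s] unchanged; if the translated path has small probability of being
    in [G], so does the path itself ([exits_within_quasi_invariance]).  Hence
    [G] is a null event, and countably many such events cover all contacts
    with the boundary.

    Path events are reduced to the finite-dimensional laws that define
    Brownian motion by observing the path along dyadic grids ([on_grid_cvg]);
    for this the sets in which the path has to stay are taken closed, and open
    sets are exhausted by the closed sets [inner_part]. *)

(** * Normal laws *)

Section normal_laws.
Context {R : realType}.
Implicit Types (m s v a : R) (A : set R).
Local Notation mu := (@lebesgue_measure R).

(** Translation on [measurableTypeR R], the copy of the line that carries
    Lebesgue measure. *)
Definition shiftr a (v : measurableTypeR R) : measurableTypeR R := v + a.

Lemma measurable_shiftr a : measurable_fun setT (shiftr a).
Proof. by apply: measurable_funD. Qed.

Lemma lebesgue_measure_translate a A : measurable A ->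
  mu A = pushforward mu (shiftr a) A.
Proof.
move=> mA.
have mshift := measurable_shiftr a.
apply: (lebesgue_measure_unique (mu := pushforward mu (shiftr a))) => //.
move=> _ [[x y]] /= _ <-.
rewrite /pushforward.
have -> : shiftr a @^-1` `]x, y] = [set` `]x - a, y - a]].
  by apply/seteqP; split => v /=; rewrite /shiftr !in_itv/= ltrBlDr lerBrDr.
rewrite !lebesgue_measure_itv/= !lte_fin ltrD2r.
by case: ifP => // _; rewrite -!EFinB; congr (_%:E); ring.
Qed.

Lemma normal_prob_translate a s A : s != 0 -> measurable A ->
  normal_prob 0 s (shiftr a @^-1` A) = normal_prob a s A.
Proof.
move=> s0 mA; rewrite /normal_prob.
have mshift := measurable_shiftr a.
rewrite [RHS](@eq_measure_integral _ _ _ _ (pushforward mu (shiftr a)) mu);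
  last first.
  by move=> B mB _; exact: lebesgue_measure_translate.
rewrite [RHS]ge0_integral_pushforward//.
- apply: eq_integral => v _ /=; congr (_%:E).
  by rewrite !normal_pdfE//= /normal_fun /shiftr addrK subr0.
- by apply/measurable_EFinP; apply/measurable_funTS; exact: measurable_normal_pdf.
- by move=> v _; rewrite lee_fin normal_pdf_ge0.
Qed.

(** [normal_pdf] is a version of the Radon-Nikodym derivative, because both
    have the same integral over every measurable set. *)
Lemma ge0_integral_normal_prob m s (f : R -> \bar R) A :
  measurable A -> measurable_fun setT f -> (forall v, 0 <= f v)%E ->
  (\int[normal_prob m s]_(v in A) f v =
   \int[mu]_(v in A) (f v * (normal_pdf m s v)%:E))%E.
Proof.
move=> mA mf f0.
rewrite -(Radon_Nikodym_SigmaFinite.change_of_variables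
  (normal_prob_dominates m s))//; last exact: measurable_funTS.
have dom := @normal_prob_dominates R m s.
have intf := Radon_Nikodym_SigmaFinite.f_integrable dom.
apply: ae_eq_integral => //.
- apply: emeasurable_funM => //; first exact: measurable_funTS.
  exact: measurable_funTS (measurable_int _ intf).
- apply: emeasurable_funM => //; first exact: measurable_funTS.
  apply/measurable_EFinP; apply/measurable_funTS; exact: measurable_normal_pdf.
- apply: ae_eqe_mul2l => /=.
  apply: integral_ae_eq => //=.
  + exact: integrableS intf.
  + apply/measurable_EFinP; apply/measurable_funTS; exact: measurable_normal_pdf.
  + by move=> E E01 mE; rewrite -(Radon_Nikodym_SigmaFinite.f_integral dom).
Qed.

(** The likelihood ratio of the normal laws with means [m'] and [m] and
    common standard deviation [s]. *)
Definition normal_tilt m m' s v : R :=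
  expR (((v - m) ^+ 2 - (v - m') ^+ 2) / (s ^+ 2 *+ 2)).

Lemma measurable_normal_tilt m m' s :
  measurable_fun [set: R] (normal_tilt m m' s).
Proof.
apply: measurableT_comp => //; apply: measurable_funM => //.
by apply: measurable_funB; apply: measurable_funX; apply: measurable_funB.
Qed.

Lemma integral_normal_tilt m m' s A : s != 0 -> measurable A ->
  (\int[normal_prob m s]_(v in A) (normal_tilt m m' s v)%:E =
   normal_prob m' s A)%E.
Proof.
move=> s0 mA; rewrite ge0_integral_normal_prob//.
- apply: eq_integral => v _; rewrite -EFinM !normal_pdfE//; congr (_%:E).
  rewrite mulrCA -expRD; congr (_ * expR _).
  by field; rewrite ?pnatr_eq0/=.
- by apply/measurable_EFinP; exact: measurable_normal_tilt.
- by move=> v; rewrite lee_fin expR_ge0.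
Qed.

(** In general the ratio is not bounded away from [0] on the whole line, but a
    lower bound away from the tails suffices to compare small probabilities. *)
Lemma normal_tilt_lb m a s v M : s != 0 -> `|a| <= 1 -> `|v - m| <= M ->
  expR (- (M *+ 2 + 1) / (s ^+ 2 *+ 2)) <= normal_tilt m (m + a) s v.
Proof.
move=> s0 a1 vM; rewrite ler_expR ler_pM2r; last first.
  by rewrite invr_gt0 pmulrn_lgt0// exprn_even_gt0.
have -> : v - (m + a) = (v - m) - a by ring.
move: a1 vM; set u := v - m; rewrite !ler_norml.
move=> /andP[a1 a2] /andP[u1 u2].
have : `|u * a| <= M * 1.
  by rewrite normrM ler_pM// ler_norml ?a1 ?u1.
by rewrite ler_norml => /andP[? ?]; nra.
Qed.

End normal_laws.

(** * Measures determined by rectangles *)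

Section rectangles.
Context {R : realType} {J : finType} {dsp : measure_display}
  {T : measurableType dsp}.
Variable Y : J -> T -> R.
Implicit Types (A : J -> set R).

Definition rectangle A : set T := [set w | forall i, A i (Y i w)].

Definition rectangles : set (set T) :=
  [set E | exists2 A, (forall i, measurable (A i)) & E = rectangle A].

Lemma rectangle_setI A B :
  rectangle A `&` rectangle B = rectangle (fun i => A i `&` B i).
Proof.
apply/seteqP; split => w; first by move=> [wA wB] i; split; [exact: wA|exact: wB].
by move=> wAB; split => i; have [] := wAB i.
Qed.

Lemma rectangles_setI_closed : setI_closed rectangles.
Proof.
move=> _ _ [A mA ->] [B mB ->]; rewrite rectangle_setI.
by exists (fun i => A i `&` B i) => // i; exact: measurableI.
Qed.

Lemma rectangles_setT : rectangles [set: T].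
Proof. by exists (fun=> setT) => //; apply/seteqP; split. Qed.

Lemma measurable_rectangle A : (forall i, measurable_fun setT (Y i)) ->
  (forall i, measurable (A i)) -> measurable (rectangle A).
Proof.
move=> mY mA.
have -> : rectangle A = \bigcap_(i in [set: J]) (Y i @^-1` A i).
  apply/seteqP; split => [w wA i _|w wA i]; first exact: wA.
  exact: (wA i).
apply: fin_bigcap_measurable => // i _.
by rewrite -[X in measurable X]setTI; exact: mY.
Qed.

(** The pi-lambda theorem: the rectangles are stable under intersection. *)
Lemma rectangles_measure_unique (m1 m2 : {measure set T -> \bar R}) :
  (forall i, measurable_fun setT (Y i)) ->
  (m1 setT < +oo)%E ->
  (forall A, (forall i, measurable (A i)) ->
     m1 (rectangle A) = m2 (rectangle A)) ->
  forall E, <<s rectangles >> E -> m1 E = m2 E.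
Proof.
move=> mY m1oo m12 E sE.
apply: (g_sigma_algebra_measure_unique rectangles _ (fun=> setT)
  _ _ m1 m2 _ _ _ _ sE) => //.
- by move=> _ [A mA ->]; exact: measurable_rectangle.
- by move=> _; exact: rectangles_setT.
- by rewrite bigcup_const.
- exact: rectangles_setI_closed.
- by move=> _ [A mA ->]; exact: m12.
Qed.

Lemma measurable_rectangles_coord i :
  measurable_fun [set: g_sigma_algebraType rectangles] (Y i).
Proof.
move=> _ B mB; rewrite setTI; apply: sub_sigma_algebra.
exists (fun j => if j == i then B else setT); first by move=> j; case: ifP.
apply/seteqP; split => w /=; first by move=> wB j; case: eqP => // ->.
by move=> /(_ i); rewrite eqxx.
Qed.

End rectangles.

Section closed_preimages.
Context {R : realType} {d : nat} {dsp : measure_display}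
  {T : measurableType dsp}.
Variable g : T -> 'rV[R]_d.
Hypothesis mg : forall i, measurable_fun setT (fun w => g w 0 i).

Lemma measurable_preimage_ball (z : 'rV[R]_d) (r : R) : 0 < r ->
  measurable (g @^-1` ball z r).
Proof.
move=> r0.
have -> : g @^-1` ball z r =
    \bigcap_(i in [set: 'I_d]) (fun w => g w 0 i) @^-1` ball (z 0 i) r.
  apply/seteqP; split => w /=; first by move=> [_ zr] i _; exact: zr.
  by move=> zr; split => // i j; rewrite ord1; exact: zr.
apply: fin_bigcap_measurable => // i _; rewrite -[X in measurable X]setTI.
apply: mg => //; exact: measurable_ball.
Qed.

(** An open set is a countable union of balls with rational centre and radius
    [1 / n], and preimages of balls of the sup norm are finite intersections of
    preimages under coordinates. *)
Lemma measurable_preimage_open (U : set 'rV[R]_d) : open U ->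
  measurable (g @^-1` U).
Proof.
move=> oU.
pose B (p : 'rV[rat]_d * nat) : set 'rV[R]_d :=
  ball (map_mx (ratr : rat -> R) p.1 : 'rV[R]_d) (p.2.+1%:R^-1).
have -> : g @^-1` U =
    \bigcup_(p in [set p | B p `<=` U]) g @^-1` B p.
  apply/seteqP; split => w /=; last by move=> [p pU wp]; exact: pU.
  move=> Ug.
  have /nbhs_ballP[e /= e0 eU] : nbhs (g w) U by exact: open_nbhs_nbhs.
  have [n ne] : exists n : nat, n.+1%:R^-1 < e / 2 :> R.
    have e20 : 0 < e / 2 by rewrite divr_gt0.
    have [n _ ns] := near_infty_natSinv_lt (PosNum e20).
    by exists n; exact: (ns n (leqnn n)).
  have /choice[q qP] (i : 'I_d) : exists q : rat,
      ball (g w 0 i) n.+1%:R^-1 (ratr q : R).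
    have n0 : 0 < n.+1%:R^-1 :> R by rewrite invr_gt0.
    have /rat_in_itvoo[q] : g w 0 i < g w 0 i + n.+1%:R^-1 by rewrite ltrDl.
    rewrite in_itv/= => /andP[q1 q2]; exists q.
    by rewrite /ball/= ltr0_norm ?subr_lt0// opprB ltrBlDl.
  have wB : ball (map_mx (ratr : rat -> R) (\row_i q i) : 'rV[R]_d)
      n.+1%:R^-1 (g w).
    split; first by rewrite invr_gt0.
    by move=> i j; rewrite ord1 !mxE; apply: ball_sym; exact: qP.
  exists (\row_i q i, n) => //= z zB; apply: eU.
  apply: (@le_ball _ _ _ (e / 2 + e / 2)); first by rewrite -splitr.
  apply: ball_triangle; first by apply: ball_sym; apply: le_ball wB; exact: ltW.
  by apply: le_ball zB; exact: ltW.
rewrite bigcup_mkcond; apply: countable_bigcupT_measurable; first exact: countableP.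
by move=> p; case: ifP => // _; apply: measurable_preimage_ball; rewrite invr_gt0.
Qed.

Lemma measurable_preimage_closed (F : set 'rV[R]_d) : closed F ->
  measurable (g @^-1` F).
Proof.
move=> cF.
have -> : g @^-1` F = ~` (g @^-1` (~` F)) by rewrite preimage_setC setCK.
by apply/measurableC/measurable_preimage_open; rewrite openC.
Qed.

End closed_preimages.

(** * Brownian motion along a time grid *)

Section partial_sums.
Context {R : realType} {d N : nat} {dsp : measure_display}
  {T : measurableType dsp}.
Variable Y : 'I_N * 'I_d -> T -> R.

(** Membership in the sigma-algebra of the rectangles, rather than mere
    measurability, is what lets a comparison of two measures on rectangles reach
    the events that a walk stays in a closed set. *)
Lemma sigma_rectangles_partial_sums (z : 'rV[R]_d) (F : set 'rV[R]_d) :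
  closed F ->
  <<s rectangles Y >> [set w | forall k : 'I_N,
    F (z + \row_i \sum_(j < N | (j <= k)%N) Y (j, i) w)].
Proof.
move=> cF.
pose g (k : 'I_N) (w : g_sigma_algebraType (rectangles Y)) : 'rV[R]_d :=
  z + \row_i \sum_(j < N | (j <= k)%N) Y (j, i) w.
have -> : [set w | forall k : 'I_N,
    F (z + \row_i \sum_(j < N | (j <= k)%N) Y (j, i) w)] =
    \bigcap_(k in [set: 'I_N]) (g k @^-1` F).
  by apply/seteqP; split => [w wF k _|w wF k]; [exact: wF|exact: (wF k)].
apply: (@fin_bigcap_measurable _ (g_sigma_algebraType (rectangles Y))) => // k _.
apply: measurable_preimage_closed => // i.
have -> : (fun w => g k w 0 i) =
    (fun w => z 0 i + \sum_(j < N) (if (j <= k)%N then Y (j, i) w else 0)).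
  by apply/funext => w; rewrite /g !mxE; congr (_ + _); exact: big_mkcond.
apply: measurable_funD => //; apply: measurable_sum => j.
by case: (j <= k)%N => //; exact: measurable_rectangles_coord.
Qed.

End partial_sums.

Lemma probability_eq_on_sure {R : realType} {dsp : measure_display}
    {T : measurableType dsp} (P : probability T R) (S A B : set T) :
  measurable S -> measurable A -> measurable B -> P S = 1%E ->
  (forall w, S w -> A w <-> B w) -> P A = P B.
Proof.
move=> mS mA mB PS AB.
have PC : P (~` S) = 0%E by rewrite probability_setC// PS subee.
have PI C : measurable C -> P C = P (C `&` S).
  move=> mC; rewrite (measureDI P mC mS) [X in (X + _)%E](_ : _ = 0%E) ?add0e//.
  apply/eqP; rewrite -measure_le0 -PC setDE; apply: le_measure; rewrite ?inE//.
    by apply: measurableI => //; exact: measurableC.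
  exact: measurableC.
rewrite PI// [RHS]PI//; congr (P _).
by apply/seteqP; split => w [wC wS]; split => //; apply/AB.
Qed.

Lemma closed_translate {R : realType} {d : nat} (b : 'rV[R]_d)
  (F : set 'rV[R]_d) : closed F -> closed [set z | F (z + b)].
Proof.
move=> cF; have : closed ((fun z => z + b) @^-1` F) by
  apply: preimage_closed => // z _; exact: (cvgD cvg_id (cvg_cst b)).
exact.
Qed.

Section brownian_grid.
Context {R : realType} {d : nat} {dsp : measure_display}
  {Omega : measurableType dsp}.
Variables (P : 'rV[R]_d -> probability Omega R) (X : R -> Omega -> 'rV[R]_d).
Hypothesis hX : brownian_family P X.

Lemma brownian_measurable (t : R) (i : 'I_d) : 0 <= t ->
  measurable_fun [set: Omega] (fun w => X t w 0 i).
Proof. by have [+ _ _ _] := hX 0; exact. Qed.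

Lemma brownian_start (y : 'rV[R]_d) : P y [set w | X 0 w = y] = 1%E.
Proof. by have [] := hX y. Qed.

Lemma measurable_brownian_start (y : 'rV[R]_d) :
  measurable [set w | X 0 w = y].
Proof.
have -> : [set w | X 0 w = y] = \bigcap_(i in [set: 'I_d])
    (setT `&` (fun w => X 0 w 0 i) @^-1` [set y 0 i]).
  apply/seteqP; split => [w /= wy i _|w wy].
    by split => //=; rewrite wy.
  by apply/rowP => i; have [] := wy i Logic.I.
apply: fin_bigcap_measurable => // i _.
exact: brownian_measurable.
Qed.

Variables (tau : nat -> R).
Hypotheses (tau0 : tau 0%N = 0) (tauS : forall k, tau k < tau k.+1).

Lemma grid_ge0 k : 0 <= tau k.
Proof. by elim: k => [|k /le_trans ->//]; [rewrite tau0|rewrite ltW]. Qed.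

Definition increment N (p : 'I_N * 'I_d) (w : Omega) : R :=
  (X (tau p.1.+1) w - X (tau p.1) w) 0 p.2.

(** The coordinates of the increments along the grid, except that the first
    increment is replaced by the first position.  Their law depends on the
    starting point only through the mean of the first block, and the positions
    on the grid after time [0] are their partial sums. *)
Definition first_position N (p : 'I_N * 'I_d) (w : Omega) : R :=
  if p.1 == 0%N :> nat then X (tau 1%N) w 0 p.2 else increment p w.

Lemma measurable_increment N p : measurable_fun setT (@increment N p).
Proof.
have -> : @increment N p =
    (fun w => X (tau p.1.+1) w 0 p.2 - X (tau p.1) w 0 p.2).
  by apply/funext => w; rewrite /increment !mxE.
by apply: measurable_funB; apply: brownian_measurable; exact: grid_ge0.
Qed.

Lemma measurable_first_position N p : measurable_fun setT (@first_position N p).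
Proof.
rewrite /first_position; case: eqP => _; last exact: measurable_increment.
by apply: brownian_measurable; exact: grid_ge0.
Qed.

Lemma increment_law N y (A : 'I_N * 'I_d -> set R) :
  (forall p, measurable (A p)) ->
  P y (rectangle (@increment N) A) =
  (\prod_(k < N) \prod_(i < d)
     normal_prob 0 (Num.sqrt (tau k.+1 - tau k)) (A (k, i)))%E.
Proof.
move=> mA; have [_ _ _ /(_ N tau (fun k i => A (k, i)))] := hX y.
move=> <- //; last by rewrite tau0.
congr (P y _); apply/seteqP; split => w wA; first by move=> k i; exact: wA.
by move=> [k i]; exact: wA.
Qed.

Lemma first_position_law N y (A : 'I_N * 'I_d -> set R) :
  (forall p, measurable (A p)) ->
  P y (rectangle (@first_position N) A) =
  (\prod_(k < N) \prod_(i < d)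
     normal_prob (if k == 0%N :> nat then y 0 i else 0)%R
       (Num.sqrt (tau k.+1 - tau k)) (A (k, i)))%E.
Proof.
move=> mA.
pose m (p : 'I_N * 'I_d) := if p.1 == 0%N :> nat then y 0 p.2 else 0.
pose B p : set R := shiftr (m p) @^-1` A p.
have mB p : measurable (B p).
  rewrite /B -[X in measurable X]setTI.
  by apply: (measurable_shiftr (m p)) => //; exact: mA.
transitivity (P y (rectangle (@increment N) B)).
  apply: (probability_eq_on_sure (measurable_brownian_start y)).
  - by apply: measurable_rectangle => // p; exact: measurable_first_position.
  - by apply: measurable_rectangle => // p; exact: measurable_increment.
  - exact: brownian_start.
  - move=> w /= wy.
    suff e p : first_position p w = increment p w + m p.
      by split => wA p; have := wA p; rewrite /B/= /shiftr e.
    rewrite /first_position /m; case: eqP => [p0|]; last by rewrite addr0.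
    by rewrite /increment p0 tau0 wy !mxE subrK.
rewrite increment_law//; apply: eq_bigr => k _; apply: eq_bigr => i _.
rewrite /B /m/= normal_prob_translate//.
by rewrite gt_eqF// sqrtr_gt0 subr_gt0.
Qed.

Lemma position_increment N (k : 'I_N) w :
  X (tau k.+1) w =
  X 0 w + \row_i \sum_(j < N | (j <= k)%N) increment (j, i) w.
Proof.
apply/rowP => i; rewrite !mxE.
rewrite (eq_bigr (fun j : 'I_N =>
  X (tau j.+1) w 0 i - X (tau j) w 0 i)); last first.
  by move=> j _; rewrite /increment !mxE.
rewrite -(big_mkord (fun j => (j <= k)%N)
  (fun j => X (tau j.+1) w 0 i - X (tau j) w 0 i)).
rewrite (big_cat_nat (n := k.+1))//=.
rewrite [X in _ = _ + (_ + X)]big_nat_cond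
  [X in _ = _ + (_ + X)]big_pred0; last first.
  by move=> j; apply/negP => /andP[/andP[kj _]]; rewrite leqNgt kj.
rewrite addr0 big_nat_cond (eq_bigl (fun j => (0 <= j < k.+1)%N)); last first.
  by move=> j; rewrite /= ltnS andbb.
by rewrite -big_nat telescope_sumr// tau0 addrC subrK.
Qed.

Lemma position_first_position N (k : 'I_N) w :
  X (tau k.+1) w =
  0 + \row_i \sum_(j < N | (j <= k)%N) first_position (j, i) w.
Proof.
case: N k => [[]//|N] k.
rewrite position_increment add0r; apply/rowP => i; rewrite !mxE.
rewrite (bigD1 ord0)//= [RHS](bigD1 ord0)//= addrA; congr (_ + _).
  by rewrite /first_position/= /increment/= !mxE tau0 addrC subrK.
apply: eq_bigr => j /andP[_ j0]; rewrite /first_position/=.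
by case: eqP => // j00; move: j0; rewrite -val_eqE/= j00.
Qed.

Definition stays_on_grid N (F : set 'rV[R]_d) : set Omega :=
  [set w | forall k : 'I_N, F (X (tau k.+1) w)].

Lemma stays_on_grid_sigma N (F : set 'rV[R]_d) : closed F ->
  <<s rectangles (@first_position N) >> (stays_on_grid N F).
Proof.
move=> /(sigma_rectangles_partial_sums (Y := @first_position N) 0).
congr (<<s _ >> _); apply/seteqP; split => w wF k.
  by rewrite (position_first_position k) ; exact: wF.
by rewrite -position_first_position; exact: wF.
Qed.

Lemma measurable_position (F : set 'rV[R]_d) (t : R) : closed F -> 0 <= t ->
  measurable [set w | F (X t w)].
Proof.
move=> cF t0; apply: (measurable_preimage_closed _ cF) => i.
exact: brownian_measurable.
Qed.

Lemma stays_on_grid_measurable N (F : set 'rV[R]_d) : closed F ->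
  measurable (stays_on_grid N F).
Proof.
move=> cF; have -> : stays_on_grid N F =
    \bigcap_(k in [set: 'I_N]) [set w | F (X (tau k.+1) w)].
  by apply/seteqP; split => [w wF k _|w wF k]; [exact: wF|exact: (wF k)].
apply: fin_bigcap_measurable => // k _; apply: measurable_position => //.
exact: grid_ge0.
Qed.

(** Given the starting point, staying on the grid is an event about increments,
    whose law is the same under all the measures [P y]. *)
Lemma stays_on_grid_translate N (y b : 'rV[R]_d) (F : set 'rV[R]_d) : closed F ->
  P (y + b) (stays_on_grid N F) = P y (stays_on_grid N [set z | F (z + b)]).
Proof.
move=> cF; have cFb := closed_translate (b := b) cF.
pose E := [set w | forall k : 'I_N,
    F (y + b + \row_i \sum_(j < N | (j <= k)%N) increment (j, i) w)].
have sE : <<s rectangles (@increment N) >> E.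
  exact: sigma_rectangles_partial_sums.
have mE : measurable E.
  move: sE; apply: smallest_sub; first exact: sigma_algebra_measurable.
  move=> _ [A mA ->]; apply: measurable_rectangle => // p.
  exact: measurable_increment.
transitivity (P (y + b) E).
  apply: (probability_eq_on_sure (measurable_brownian_start (y + b))) => //.
  - exact: stays_on_grid_measurable.
  - exact: brownian_start.
  - by move=> w /= wy; rewrite /stays_on_grid /E/=; split => wF k; have := wF k;
      rewrite position_increment wy.
transitivity (P y E).
  apply: (rectangles_measure_unique (Y := @increment N)) => //.
  - by move=> p; exact: measurable_increment.
  - by rewrite [ltLHS]probability_setT ltry.
  - by move=> A mA; exact: etrans (increment_law _ mA) (esym (increment_law _ mA)).
apply: (probability_eq_on_sure (measurable_brownian_start y)) => //.
- exact: stays_on_grid_measurable.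
- exact: brownian_start.
- by move=> w /= wy; rewrite /stays_on_grid /E/=; split => wF k; have := wF k;
    rewrite position_increment wy addrAC.
Qed.

End brownian_grid.

(** * Moving the starting point *)

(** Needed to integrate over the part of the space where the later increments
    lie in a given rectangle. *)
Lemma ge0_integral_mrestr {R : realType} {dsp : measure_display}
    {T : measurableType dsp} (mu : {measure set T -> \bar R}) (B C : set T)
    (mB : measurable B) (f : T -> \bar R) :
  measurable C -> measurable_fun setT f -> (forall w, 0 <= f w)%E ->
  (\int[mrestr mu mB]_(w in C) f w = \int[mu]_(w in B `&` C) f w)%E.
Proof.
move=> mC mf f0.
have CE : C = (C `&` B) `|` (C `&` ~` B) by rewrite -setIUr setUv setIT.
rewrite [in LHS]CE.
rewrite ge0_integral_setU//=; first last.
- by apply/disj_setPS => w [[_ ?] [_ ?]].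
- exact: measurable_funTS.
- by apply: measurableI => //; exact: measurableC.
- exact: measurableI.
rewrite [X in (_ + X)%E](_ : _ = 0%E) ?adde0; last first.
  apply: null_set_integral => //.
  - by apply: measurableI => //; exact: measurableC.
  - exact: measurable_funTS.
  - by rewrite /= /mrestr -setIA setICl setI0 measure0.
rewrite setIC; apply: eq_measure_integral => A mA AB.
by rewrite /= /mrestr setIidl// => w /AB[].
Qed.

(** If the event [B] is independent of [V], with [k] the probability of [B]
    and [nu] the law of [V], the integral of [f V] over [B] factors. *)
Lemma ge0_integral_independent {R : realType} {dsp : measure_display}
    {T : measurableType dsp} (mu : {measure set T -> \bar R})
    (nu : {measure set (measurableTypeR R) -> \bar R})
    (V : T -> measurableTypeR R) (B : set T) (k : {nonneg R})
    (f : measurableTypeR R -> \bar R)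
    (A : set (measurableTypeR R)) :
  measurable_fun setT V -> measurable B -> measurable A ->
  measurable_fun setT f -> (forall v, 0 <= f v)%E ->
  (forall C : set (measurableTypeR R), measurable C ->
     mu (B `&` V @^-1` C) = (k%:num%:E * nu C)%E) ->
  (\int[mu]_(w in B `&` V @^-1` A) f (V w) =
   k%:num%:E * \int[nu]_(v in A) f v)%E.
Proof.
move=> mV mB mA mf f0 ind.
have mVA : measurable (V @^-1` A) by rewrite -[X in measurable X]setTI; exact: mV.
rewrite -(ge0_integral_mrestr mu mB mVA (f := f \o V))//; last 2 first.
- exact: measurableT_comp.
- by move=> w; exact: f0.
rewrite -(ge0_integral_pushforward mV)//; last exact: measurable_funTS.
rewrite -ge0_integral_mscale//; last exact: measurable_funTS.
apply: eq_measure_integral => C mC _.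
by rewrite /= /pushforward /mrestr/= setIC ind.
Qed.

Section integral_as_measure.
Context {R : realType} {dsp : measure_display} {T : measurableType dsp}.
Variables (mu : {measure set T -> \bar R}) (f : T -> \bar R).
Hypotheses (mf : measurable_fun setT f) (f0 : forall w, (0 <= f w)%E).

(** The measure with density [f] with respect to [mu].  The two hypotheses on
    [f] are arguments so that the measure structure can be inferred from the
    term. *)
Definition weighted (_ : measurable_fun setT f) (_ : forall w, (0 <= f w)%E)
  (E : set T) : \bar R := (\int[mu]_(w in E) f w)%E.
Local Notation nu := (weighted mf f0).

Let weighted0 : nu set0 = 0%E.
Proof. exact: integral_set0. Qed.

Let weighted_ge0 E : (0 <= nu E)%E.
Proof. exact: integral_ge0. Qed.

Let weighted_sigma_additive : semi_sigma_additive nu.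
Proof.
move=> A mA tA mUA; rewrite /weighted ge0_integral_bigcup//; last first.
  exact: measurable_funTS.
by apply: is_cvg_ereal_nneg_natsum_cond => n _ _; exact: integral_ge0.
Qed.

HB.instance Definition _ := isMeasure.Build _ _ _ nu
  weighted0 weighted_ge0 weighted_sigma_additive.

End integral_as_measure.

Lemma normal_prob_tail {R : realType} (s e : R) : 0 < e ->
  exists2 M : R, 0 <= M & (normal_prob 0 s [set v | (M < `|v|)%R] <= e%:E)%E.
Proof.
move=> e0; pose A (n : nat) : set R := [set v | n%:R < `|v|].
have mA n : measurable (A n).
  rewrite -[A n]setTI (_ : A n = (@Num.norm R R) @^-1` `]n%:R, +oo[).
    by apply: normr_measurable => //; exact: measurable_itv.
  by apply/seteqP; split => v /=; rewrite in_itv/= andbT.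
have A0 : \bigcap_n A n = set0.
  apply/seteqP; split => // v /(_ (Num.bound `|v|) Logic.I).
  by rewrite /A/= ltNge ltW// archi_boundP.
have : normal_prob 0 s \o A @ \oo --> (0 : \bar R).
  rewrite -(measure0 (normal_prob 0 s)) -A0.
  apply: nonincreasing_cvg_mu => //.
  - apply: le_lt_trans (@probability_le1 _ _ _ (normal_prob 0 s) _ (mA 0%N)) _.
    by rewrite ltry.
  - by rewrite A0.
  - move=> m n mn; apply/subsetPset => v; apply: le_lt_trans.
    by rewrite ler_nat.
move=> /fine_cvgP[_ /cvgrPdist_lt /(_ _ e0)[n _ /(_ n (leqnn n))]].
rewrite /= sub0r normrN ger0_norm ?fine_ge0// => lte.
exists n%:R => //; rewrite -[leLHS]fineK; first by rewrite lee_fin ltW.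
by apply: fin_num_measure; exact: (mA n).
Qed.

Section brownian_quasi_invariance.
Context {R : realType} {d : nat} {dsp : measure_display}
  {Omega : measurableType dsp}.
Variables (P : 'rV[R]_d -> probability Omega R) (X : R -> Omega -> 'rV[R]_d).
Hypothesis hX : brownian_family P X.

Section fixed_grid.
Variables (tau : nat -> R) (n : nat).
Hypotheses (tau0 : tau 0%N = 0) (tauS : forall k, tau k < tau k.+1).
Local Notation Y := (@first_position R d dsp Omega X tau n.+1).
Local Notation index := ('I_n.+1 * 'I_d)%type.
Local Notation s := (Num.sqrt (tau 1%N)).

Let mean (y : 'rV[R]_d) (p : index) : R :=
  if p.1 == 0%N :> nat then y 0 p.2 else 0.
Let sd (p : index) : R := Num.sqrt (tau p.1.+1 - tau p.1).

Let s_neq0 : s != 0.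
Proof. by rewrite gt_eqF// sqrtr_gt0 -tau0 tauS. Qed.

Let law y (A : index -> set R) : (forall p, measurable (A p)) ->
  P y (rectangle Y A) = (\prod_p normal_prob (mean y p) (sd p) (A p))%E.
Proof.
move=> mA; rewrite (first_position_law hX)// pair_bigA/=.
by apply: eq_bigr => -[].
Qed.

Lemma first_position_marginal y i (C : set R) : measurable C ->
  P y [set w | C (X (tau 1%N) w 0 i)] = normal_prob (y 0 i) s C.
Proof.
move=> mC; pose p0 : index := (ord0, i).
pose A p := if p == p0 then C else setT.
have mA p : measurable (A p) by rewrite /A; case: eqP.
have -> : [set w | C (X (tau 1%N) w 0 i)] = rectangle Y A.
  apply/seteqP; split => w /=; first by move=> wC p; rewrite /A; case: eqP => // ->.
  by move=> /(_ p0); rewrite /A eqxx.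
rewrite law// (bigD1 p0)//= big1 ?mule1; last first.
  by move=> p pp0; rewrite /A (negbTE pp0); exact: probability_setT.
by rewrite /A eqxx /mean /sd/= tau0 subr0.
Qed.

Let tilt (y : 'rV[R]_d) (a : R) (i : 'I_d) (w : Omega) : \bar R :=
  (normal_tilt (y 0 i) (y 0 i + a) s (X (tau 1%N) w 0 i))%:E.

Let tilt_ge0 y a i w : (0 <= tilt y a i w)%E.
Proof. by rewrite lee_fin expR_ge0. Qed.

Let measurable_tilt y a i : measurable_fun setT (tilt y a i).
Proof.
apply/measurable_EFinP/measurableT_comp; first exact: measurable_normal_tilt.
by apply: (brownian_measurable hX); exact: grid_ge0.
Qed.

(** The Cameron-Martin formula for a translation of the first position on the
    grid along one coordinate: on rectangles only one factor of the product law
    changes, by the likelihood ratio of two normal laws. *)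
Lemma brownian_tilt (y : 'rV[R]_d) (a : R) (i : 'I_d) (E : set Omega) :
  <<s rectangles Y >> E ->
  P (y + a *: delta_mx 0 i) E = (\int[P y]_(w in E) tilt y a i w)%E.
Proof.
pose m2 := weighted (P y) (measurable_tilt y a i) (tilt_ge0 y a i).
have mY p : measurable_fun setT (Y p) by exact: measurable_first_position.
apply: (rectangles_measure_unique (m1 := P (y + a *: delta_mx 0 i)) (m2 := m2) mY).
  by rewrite [ltLHS]probability_setT ltry.
move=> A mA; apply: etrans (law _ mA) _.
pose p0 : index := (ord0, i).
pose AC (C : set R) p := if p == p0 then C else A p.
have mAC C p : measurable C -> measurable (AC C p).
  by rewrite /AC; case: eqP.
pose V w : measurableTypeR R := X (tau 1%N) w 0 i.
have rectAC C : rectangle Y (AC C) = rectangle Y (AC setT) `&` V @^-1` C.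
  apply/seteqP; split => w.
    move=> wC; split; last by have := wC p0; rewrite /AC eqxx.
    by move=> p; have := wC p; rewrite /AC; case: eqP.
  move=> [wT wC] p; have := wT p; rewrite /AC.
  by case: eqP => // ->.
have split_p0 (F : index -> \bar R) :
    (\prod_p F p = (\prod_(p | p != p0) F p) * F p0)%E.
  by rewrite (bigD1 p0)//= muleC.
have mean_p0 v : mean v p0 = v 0 i by [].
have sd_p0 : sd p0 = s by rewrite /sd/= tau0 subr0.
pose K : \bar R := (\prod_(p | p != p0) normal_prob (mean y p) (sd p) (A p))%E.
have K0 : (0 <= K)%E by apply: prode_ge0 => p _; exact: measure_ge0.
have Kfin : K \is a fin_num.
  by apply: prode_fin_num => p _; apply: fin_num_measure; exact: mA.
have lawC C : measurable C -> P y (rectangle Y (AC C)) =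
    (K * normal_prob (y 0%R i) s C)%E.
  move=> mC; rewrite law; last by move=> p; exact: mAC.
  rewrite split_p0 {2}/AC eqxx mean_p0 sd_p0.
  have -> // : (\prod_(p | p != p0) normal_prob (mean y p) (sd p) (AC C p))%E = K.
  by apply: eq_bigr => p pp0; rewrite /AC (negbTE pp0).
have k0 : 0 <= fine K by rewrite fine_ge0.
rewrite [RHS](_ : _ = (fine K)%:E * normal_prob (y 0 i + a)%R s (A p0))%E;
  last first.
  rewrite /m2 /weighted.
  have {1}-> : rectangle Y A = rectangle Y (AC setT) `&` V @^-1` A p0.
    rewrite -rectAC; congr (rectangle _ _); apply/funext => p.
    by rewrite /AC; case: eqP => // ->.
  rewrite -(@integral_normal_tilt R (y 0 i) _ s _ s_neq0 (mA p0)).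
  apply: (@ge0_integral_independent _ _ _ (P y) (normal_prob (y 0 i) s) V _
    (NngNum k0)
    (fun v => (normal_tilt (y 0 i) (y 0 i + a) s v)%:E)) => //.
  - by apply: (brownian_measurable hX); exact: grid_ge0.
  - by apply: measurable_rectangle => // p; exact: mAC.
  - exact: mA.
  - by apply/measurable_EFinP; exact: measurable_normal_tilt.
  - by move=> v; rewrite lee_fin expR_ge0.
  - by move=> C mC; rewrite -rectAC /= fineK// lawC.
have mean_shift : mean (y + a *: delta_mx 0 i) p0 = y 0 i + a.
  by rewrite mean_p0 !mxE !eqxx mulr1.
rewrite (fineK Kfin) split_p0 mean_shift sd_p0.
suff -> : (\prod_(p | p != p0)
  normal_prob (mean (y + a *: delta_mx 0 i)%R p) (sd p) (A p))%E = K by [].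
apply: eq_bigr => -[k j] pp0.
suff -> : mean (y + a *: delta_mx 0 i) (k, j) = mean y (k, j) by [].
rewrite /mean/=; case: ifPn => // /eqP k0'; rewrite !mxE eqxx/=.
case: eqP => [ji|_]; last by rewrite mulr0 addr0.
by move: pp0; rewrite /p0 ji xpair_eqE eqxx andbT -val_eqE/= k0'.
Qed.

End fixed_grid.

(** The density of [brownian_tilt] is at least [c] where the [i]-th coordinate
    of the first position is within [M] of [y 0 i], and the complement has
    probability at most [e / 2].  It matters that [dl] depends neither on the
    starting point nor on the grid after its first positive time [t]: grids
    will be refined and starting points moved again. *)
Lemma one_coordinate_quasi_invariance (t e : R) : 0 < t -> 0 < e ->
  exists2 dl : R, 0 < dl &
  forall (y : 'rV[R]_d) (i : 'I_d) (a : R) (tau : nat -> R) (n : nat)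
    (E : set Omega),
    `|a| <= 1 -> tau 0%N = 0 -> (forall k, tau k < tau k.+1) -> tau 1%N = t ->
    <<s rectangles (@first_position R d dsp Omega X tau n.+1) >> E ->
    (P (y + a *: delta_mx 0 i)%R E <= dl%:E -> P y E <= e%:E)%E.
Proof.
move=> t0 e0; pose s := Num.sqrt t.
have s0 : s != 0 by rewrite gt_eqF// sqrtr_gt0.
have e20 : 0 < e / 2 by rewrite divr_gt0.
have [M M0 tail] := normal_prob_tail s e20.
pose c := expR (- (M *+ 2 + 1) / (s ^+ 2 *+ 2)).
have c0 : 0 < c by exact: expR_gt0.
exists (c * (e / 2)); first exact: mulr_gt0.
move=> y i a tau n E a1 tau0 tauS taut sE.
have mE : measurable E.
  move: sE; apply: smallest_sub; first exact: sigma_algebra_measurable.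
  by move=> _ [A mA ->]; apply: measurable_rectangle => // p;
    exact: measurable_first_position.
rewrite (brownian_tilt tau0 tauS _ _ _ sE)/= taut -/s => Ele.
pose F := [set w | `|X t w 0 i - y 0 i| <= M].
have mXt : measurable_fun setT (fun w => X t w 0 i).
  by apply: (brownian_measurable hX); rewrite ltW.
have mF : measurable F.
  have -> : F = setT `&` (fun w => X t w 0 i - y 0 i) @^-1` `[- M, M].
    by apply/seteqP; split => w; rewrite /F/= in_itv/= ler_norml => // -[].
  by apply: measurable_funB => //; exact: measurable_itv.
have : (c%:E * P y (E `&` F) <= (c * (e / 2))%:E)%E.
  apply: le_trans Ele; rewrite -integral_cst; last exact: measurableI.
  apply: (@le_trans _ _ (\int[P y]_(w in E `&` F)
      (normal_tilt (y 0 i) (y 0 i + a) s (X t w 0 i))%:E)%E).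
    apply: ge0_le_integral => //.
    - exact: measurableI.
    - by move=> w _; rewrite lee_fin ltW.
    - apply/measurable_EFinP/measurable_funTS/measurableT_comp => //.
      exact: measurable_normal_tilt.
    - by move=> w [_ wF]; rewrite lee_fin; exact: normal_tilt_lb.
  apply: ge0_subset_integral => //.
  - exact: measurableI.
  - apply/measurable_EFinP/measurable_funTS/measurableT_comp => //.
    exact: measurable_normal_tilt.
  - by move=> w _; rewrite lee_fin expR_ge0.
rewrite EFinM lee_pmul2l// => EF.
have FC : (P y (~` F) <= (e / 2)%:E)%E.
  have -> : ~` F = [set w | [set v | M < `|v - y 0 i|] (X (tau 1%N) w 0 i)].
    by apply/seteqP; split => w; rewrite /F/= taut ltNge => /negP.
  have mT : measurable [set v : R | M < `|v - y 0 i|].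
    rewrite (_ : mkset _ = setT `&`
      (fun v : R => `|v - y 0 i|) @^-1` `]M, +oo[); last first.
      by apply/seteqP; split => v /=; rewrite in_itv/= andbT// => -[].
    have mN : measurable_fun setT (fun v : R => `|v - y 0 i|).
      by apply: measurableT_comp => //; exact: measurable_funB.
    by apply: mN => //; exact: measurable_itv.
  rewrite (first_position_marginal n tau0 tauS y i mT) taut -/s.
  rewrite -normal_prob_translate// (_ : _ @^-1` _ = [set v | M < `|v|])//.
  by apply/seteqP; split => v /=; rewrite /shiftr addrK.
rewrite (measureDI (P y) mE mF) [e in (_ <= e%:E)%E]splitr EFinD addeC.
apply: leeD => //; apply: le_trans FC; apply: le_measure; rewrite ?inE.
- exact: measurableD.
- exact: measurableC.
- by move=> w [].
Qed.

End brownian_quasi_invariance.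

(** * Paths that stay in a set *)

Section inner_parts.
Context {R : realType} {d : nat}.
Implicit Types (U F : set 'rV[R]_d) (z b : 'rV[R]_d) (rho : R).

(** The points at distance at least [rho] from the complement of [U], for the
    sup norm. *)
Definition inner_part U rho : set 'rV[R]_d :=
  [set z | forall y, ~ U y -> rho <= `|y - z|].

Lemma inner_part_sub U rho : 0 < rho -> inner_part U rho `<=` U.
Proof.
move=> rho0 z zU; apply: contrapT => /zU.
by rewrite subrr normr0 leNgt rho0.
Qed.

Lemma inner_partS U rho1 rho2 : rho1 <= rho2 ->
  inner_part U rho2 `<=` inner_part U rho1.
Proof. by move=> le12 z zU y /zU; exact: le_trans. Qed.

Lemma closed_inner_part U rho : closed (inner_part U rho).
Proof.
move=> z zK y yU; rewrite leNgt; apply/negP => yz.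
have yz0 : 0 < rho - `|y - z| by rewrite subr_gt0.
have [v [vK]] := zK _ (nbhsx_ballx z _ yz0).
rewrite -ball_normE /= => zv; have := vK _ yU.
have -> : y - v = (y - z) + (z - v) by rewrite addrA subrK.
by move=> /le_trans/(_ (ler_normD _ _)); lra.
Qed.

Lemma inner_part_translate U rho b :
  [set z | inner_part U rho (z + b)] = inner_part [set z | U (z + b)] rho.
Proof.
apply/seteqP; split => z zU y.
  by move=> yU; have := zU _ yU; rewrite opprD addrACA subrr addr0.
by move=> yU; have := zU (y - b); rewrite /= subrK opprD addrA addrAC => /(_ yU).
Qed.

Lemma inner_part_move U rho z v :
  inner_part U rho z -> `|v - z| <= rho / 2 -> inner_part U (rho / 2) v.
Proof.
move=> zU vz y /zU; have -> : y - z = (y - v) + (v - z) by rewrite addrA subrK.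
by move=> /le_trans/(_ (ler_normD _ _)); lra.
Qed.

Lemma compact_inner_part U (C : set 'rV[R]_d) : open U -> compact C -> C `<=` U ->
  exists n : nat, C `<=` inner_part U n.+1%:R^-1.
Proof.
move=> oU cC CU.
have : \forall n \near \oo, C `<=` inner_part U n.+1%:R^-1.
  move/compact_near_coveringP : cC => cC.
  apply: (cC nat \oo (fun n => inner_part U n.+1%:R^-1)) => z /CU Uz.
  have /nbhs_ballP[e /= e0 eU] : nbhs z U by exact: open_nbhs_nbhs.
  have e20 : 0 < e / 2 by rewrite divr_gt0.
  exists (ball z (e / 2), [set n | n.+1%:R^-1 < e / 2]) => /=.
    split; first exact: nbhsx_ballx.
    exact: (near_infty_natSinv_lt (PosNum e20)).
  move=> [v n] [/= zv ne] y yU; rewrite leNgt; apply/negP => yv.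
  apply: yU; apply: eU; rewrite [e]splitr.
  apply: ball_triangle zv _; rewrite -ball_normE /= distrC.
  exact: lt_trans yv _.
by move=> [n _ /(_ n (leqnn n))]; exists n.
Qed.

End inner_parts.

Section stays.
Context {R : realType} {d : nat} {Omega : Type}.
Variable X : R -> Omega -> 'rV[R]_d.
Hypothesis Xcont : forall w, {within `[0, +oo[, continuous (fun t => X t w)}.

Definition stays (s u : R) (F : set 'rV[R]_d) : set Omega :=
  [set w | forall r, s <= r <= u -> F (X r w)].

Lemma staysS s u F G : F `<=` G -> stays s u F `<=` stays s u G.
Proof. by move=> FG w wF r /wF/FG. Qed.

Lemma path_continuous w r e : 0 <= r -> 0 < e ->
  exists2 dl : R, 0 < dl &
    forall q, 0 <= q -> `|q - r| < dl -> ball (X r w) e (X q w).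
Proof.
move=> r0 e0; have /subspace_continuousP/(_ r) := @Xcont w.
rewrite /= in_itv/= r0 => /(_ isT)/cvg_ballP/(_ _ e0).
rewrite near_withinE => /nbhs_ballP[dl /= dl0 dlX].
exists dl => // q q0 qr; apply: dlX; last by rewrite /= in_itv/= q0.
by rewrite -ball_normE/= distrC.
Qed.

(** The path is continuous and the set is closed, so one time near each [r]
    suffices. *)
Lemma stays_dense (s u : R) (F : set 'rV[R]_d) w : closed F ->
  0 <= s ->
  (forall r dl, s <= r <= u -> 0 < dl ->
     exists q, [/\ 0 <= q, `|q - r| < dl & F (X q w)]) ->
  stays s u F w.
Proof.
move=> cF s0 dense r rsu; apply: cF => B /nbhs_ballP[e /= e0 eB].
have r0 : 0 <= r by case/andP : rsu => /(le_trans s0).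
have [dl dl0 dlX] := path_continuous w r0 e0.
have [q [q0 qr Fq]] := dense _ _ rsu dl0.
by exists (X q w); split => //; exact/eB/dlX.
Qed.

(** The path between the times [s] and [u] is compact. *)
Lemma stays_open_exhaust s u (A U : set 'rV[R]_d) : open U -> 0 <= s ->
  stays s u A `&` stays s u U =
  \bigcup_n stays s u (A `&` inner_part U n.+1%:R^-1).
Proof.
move=> oU s0; apply/seteqP; split => w; last first.
  move=> [n _ wn]; split; first by apply: staysS wn => z [].
  by apply: staysS wn => z [_]; apply: inner_part_sub; rewrite invr_gt0.
move=> [wA wU]; pose C := (fun t => X t w) @` `[s, u].
have cC : compact C.
  apply: continuous_compact; last exact: segment_compact.
  apply: continuous_subspaceW (@Xcont w) => r /=; rewrite !in_itv/= andbT.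
  by move=> /andP[/(le_trans s0)].
have CU : C `<=` U by move=> _ [r /= + <-]; rewrite in_itv/=; exact: wU.
have [n Cn] := compact_inner_part oU cC CU.
exists n => // r rsu; split; first exact: wA.
by apply: Cn; exists r => //=; rewrite in_itv.
Qed.

(** The strict inequality corresponds to the closed interval [[0, t]]: a path
    that is in the open set [D] at time [t] remains there for a while. *)
Lemma exit_timeP (D : set 'rV[R]_d) (t : R) w : open D -> 0 < t ->
  (t%:E < exit_time (X^~ w) D)%E <-> stays 0 t D w.
Proof.
move=> oD t0; split=> [tX r /andP[r0 rt]|tD].
  apply: contrapT => rD; move: tX; apply/negP; rewrite -leNgt.
  apply: (@le_trans _ _ r%:E); last by rewrite lee_fin.
  by apply: ereal_inf_lbound; exists r.
have /(_ t) : stays 0 t D w by [].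
rewrite lexx ltW// => /(_ isT) Dt.
have /nbhs_ballP[e /= e0 eD] : nbhs (X t w) D by exact: open_nbhs_nbhs.
have [dl dl0 dlX] := path_continuous w (ltW t0) e0.
apply: (@lt_le_trans _ _ (t + dl)%:E); first by rewrite lte_fin ltrDl.
apply: le_ereal_inf_tmp => _ [r [r0 rD] <-]; rewrite lee_fin leNgt.
apply/negP => rt.
apply: rD; have [rt'|tr] := leP r t; first by apply: tD; rewrite r0.
by apply/eD/dlX => //; rewrite gtr0_norm ?subr_gt0// ltrBlDl.
Qed.

End stays.

Section dyadic_grid.
Context {R : realType}.
Implicit Types s u : R.

(** Time [0] followed by the dyadic subdivision of level [n] of [[s, u]]; the
    grid is meaningful up to the index [2 ^ n + 1], which is time [u]. *)
Definition dyadic_grid s u (n k : nat) : R :=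
  if k is k'.+1 then s + (u - s) * k'%:R / 2 ^+ n else 0.

Lemma dyadic_gridS s u n k : 0 < s -> s < u ->
  dyadic_grid s u n k < dyadic_grid s u n k.+1.
Proof.
move=> s0 su; have us : 0 < u - s by rewrite subr_gt0.
case: k => [|k] /=; first by rewrite mulr0 mul0r addr0.
by rewrite ltrD2l ltr_pM2r ?invr_gt0 ?exprn_gt0// ltr_pM2l// ltr_nat.
Qed.

Lemma dyadic_grid_refine s u n k :
  dyadic_grid s u n k.+1 = dyadic_grid s u n.+1 k.*2.+1.
Proof.
rewrite /= exprS -muln2 natrM; congr (_ + _).
by field; rewrite ?expf_neq0 ?pnatr_eq0.
Qed.

Lemma dyadic_grid_itv s u n (k : 'I_(2 ^ n).+1) : s < u ->
  s <= dyadic_grid s u n k.+1 <= u.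
Proof.
move=> su; have us : 0 < u - s by rewrite subr_gt0.
have kn : 0 <= (k%:R / 2 ^+ n : R) <= 1.
  rewrite divr_ge0 ?exprn_ge0//= ler_pdivrMr ?exprn_gt0// mul1r.
  by rewrite -natrX ler_nat -ltnS.
rewrite /= -mulrA; case/andP: kn => k0 k1; apply/andP; split.
  by rewrite lerDl mulr_ge0// ltW.
by rewrite -lerBrDl ler_piMr// ltW.
Qed.

Lemma dyadic_grid_dense s u r dl : s < u -> s <= r <= u -> 0 < dl ->
  exists n (k : 'I_(2 ^ n).+1), `|dyadic_grid s u n k.+1 - r| < dl.
Proof.
move=> su /andP[sr ru] dl0; have us : 0 < u - s by rewrite subr_gt0.
pose n := Num.bound ((u - s) / dl).
have n2 : (u - s) / 2 ^+ n < dl.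
  rewrite ltr_pdivrMr ?exprn_gt0// mulrC -ltr_pdivrMr//.
  apply: lt_le_trans (archi_boundP _) _; first by rewrite divr_ge0// ltW.
  by rewrite -natrX ler_nat ltnW// ltn_expl.
pose v := (r - s) / (u - s) * 2 ^+ n.
have v0 : 0 <= v by rewrite mulr_ge0 ?exprn_ge0// divr_ge0// ?subr_ge0// ltW.
have vn : v <= 2 ^+ n.
  by rewrite ler_piMl ?exprn_ge0// ler_pdivrMr// mul1r lerD2r.
have kv : (Num.truncn v < (2 ^ n).+1)%N.
  by rewrite ltnS -(ler_nat R) natrX; apply: le_trans vn; rewrite truncn_le.
exists n, (Ordinal kv) => /=.
have /andP[k1 k2] := Num.Theory.truncn_itv v0.
have -> : s + (u - s) * (Num.truncn v)%:R / 2 ^+ n - r =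
    - ((u - s) / 2 ^+ n * (v - (Num.truncn v)%:R)).
  rewrite /v; set k := _%:R; field.
  by rewrite gt_eqF// expf_neq0// pnatr_eq0.
rewrite normrN ger0_norm; last first.
  by rewrite mulr_ge0 ?subr_ge0// divr_ge0 ?exprn_ge0// ltW.
apply: le_lt_trans n2; rewrite ler_piMr//.
  by rewrite divr_ge0 ?exprn_ge0// ltW.
by rewrite lerBlDl natr1 ltW.
Qed.

End dyadic_grid.

(** * Probabilities of staying in a set *)

Section brownian_paths.
Context {R : realType} {d : nat} {dsp : measure_display}
  {Omega : measurableType dsp}.
Variables (P : 'rV[R]_d -> probability Omega R) (X : R -> Omega -> 'rV[R]_d).
Hypothesis hX : brownian_family P X.
Implicit Types (y a b : 'rV[R]_d) (A F U : set 'rV[R]_d) (s u : R).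

Lemma brownian_continuous w : {within `[0, +oo[, continuous (fun t => X t w)}.
Proof. by have [_ + _ _] := hX 0; exact. Qed.

Let on_grid s u n F : set Omega :=
  stays_on_grid X (dyadic_grid s u n) (2 ^ n).+1 F.

Let on_grid_measurable s u n F : 0 < s -> s < u -> closed F ->
  measurable (on_grid s u n F).
Proof.
move=> s0 su cF; apply: (stays_on_grid_measurable hX) => // k.
exact: dyadic_gridS.
Qed.

Lemma stays_dyadic s u F : 0 < s -> s < u -> closed F ->
  stays X s u F = \bigcap_n on_grid s u n F.
Proof.
move=> s0 su cF; apply/seteqP; split => w wF.
  by move=> n _ k; apply: wF; exact: dyadic_grid_itv.
apply: (stays_dense brownian_continuous) => //; first exact: ltW.
move=> r dl rsu dl0; have [n [k rk]] := dyadic_grid_dense su rsu dl0.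
exists (dyadic_grid s u n k.+1); split => //; last exact: (wF n Logic.I k).
by apply: (le_trans (ltW s0)); case/andP: (dyadic_grid_itv k su).
Qed.

(** Each level of the grid contains the preceding one. *)
Lemma on_grid_nonincreasing s u F : nonincreasing_seq (fun n => on_grid s u n F).
Proof.
apply/nonincreasing_seqP => n; apply/subsetPset => w wF k.
have k2 : (k.*2 < (2 ^ n.+1).+1)%N.
  by rewrite ltnS expnS mul2n leq_double -ltnS.
by have := wF (Ordinal k2); rewrite -dyadic_grid_refine.
Qed.

Lemma probability_lty y (E : set Omega) : measurable E -> (P y E < +oo)%E.
Proof.
by move=> mE; apply: le_lt_trans (probability_le1 _ mE) _; rewrite ltry.
Qed.

Lemma measurable_stays_pos s u F : 0 < s -> s < u -> closed F ->
  measurable (stays X s u F).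
Proof.
move=> s0 su cF; rewrite stays_dyadic//; apply: bigcapT_measurable => n.
exact: on_grid_measurable.
Qed.

Lemma on_grid_cvg y s u F : 0 < s -> s < u -> closed F ->
  P y (on_grid s u n F) @[n --> \oo] --> P y (stays X s u F).
Proof.
move=> s0 su cF; have mF := measurable_stays_pos s0 su cF.
rewrite stays_dyadic// in mF *; apply: nonincreasing_cvg_mu => //.
- by apply: probability_lty; exact: on_grid_measurable.
- by move=> n; exact: on_grid_measurable.
- exact: on_grid_nonincreasing.
Qed.

(** Brings intervals that start at time [0], where the grids would not be
    increasing, back to intervals that start at a positive time. *)
Lemma stays_from_zero u F : 0 < u -> closed F ->
  stays X 0 u F = \bigcap_n stays X (u / n.+2%:R) u F.
Proof.
move=> u0 cF; apply/seteqP; split => w wF.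
  move=> n _ r /andP[nr ru]; apply: wF; rewrite ru andbT.
  by apply: le_trans nr; rewrite divr_ge0// ltW.
have pos r : 0 < r <= u -> F (X r w).
  move=> /andP[r0 ru]; pose n := Num.bound (u / r).
  apply: (wF n Logic.I); rewrite ru andbT ler_pdivrMr// mulrC -ler_pdivrMr//.
  apply: ltW; apply: lt_trans (archi_boundP _) _.
    by rewrite divr_ge0// ltW.
  by rewrite ltr_nat ltnS leqnSn.
apply: (stays_dense brownian_continuous) => // r dl /andP[r0 ru] dl0.
have [r_gt0|r_le0] := ltP 0 r.
  by exists r; split => //; rewrite ?subrr ?normr0//; apply: pos; rewrite r_gt0.
have -> : r = 0 by apply/eqP; rewrite eq_le r_le0.
pose q := Num.min u (dl / 2).
have q0 : 0 < q by rewrite lt_min u0/= divr_gt0.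
exists q; split => //; first exact: ltW.
  rewrite subr0 gtr0_norm// /q gt_min; apply/orP; right.
  by rewrite ltr_pdivrMr//; lra.
by apply: pos; rewrite q0/= ge_min lexx.
Qed.

Lemma measurable_stays s u F : 0 <= s -> s < u -> closed F ->
  measurable (stays X s u F).
Proof.
rewrite le_eqVlt => /predU1P[<- u0 cF|s0 su cF]; last exact: measurable_stays_pos.
rewrite stays_from_zero//; apply: bigcapT_measurable => n.
apply: measurable_stays_pos => //; first exact: divr_gt0.
by rewrite ltr_pdivrMr// ltr_pMr// ltr1n.
Qed.

(** Under [P (y + b)] the path behaves like the path under [P y] translated by
    [b]: this holds along every dyadic grid, hence in the limit. *)
Lemma stays_translate s u y b F : 0 <= s -> s < u -> closed F ->
  P (y + b) (stays X s u F) = P y (stays X s u [set z | F (z + b)]).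
Proof.
move=> s_ge0 su cF; have cFb := closed_translate (b := b) cF.
have pos v : 0 < v -> v < u ->
    P (y + b) (stays X v u F) = P y (stays X v u [set z | F (z + b)]).
  move=> v0 vu; have lim1 := on_grid_cvg (y := y + b) v0 vu cF.
  have lim2 := on_grid_cvg (y := y) v0 vu cFb.
  rewrite -(cvg_lim _ lim1)// -(cvg_lim _ lim2)//; congr (lim (_ @ \oo)).
  apply/funext => n; apply: (stays_on_grid_translate hX) => // k.
  exact: dyadic_gridS.
move: s_ge0 su; rewrite le_eqVlt => /predU1P[<- u0|s0 su]; last exact: pos.
have un n : 0 < u / n.+2%:R < u.
  by rewrite divr_gt0//= ltr_pdivrMr// ltr_pMr// ltr1n.
have Plim v G : closed G ->
    P v (stays X (u / n.+2%:R) u G) @[n --> \oo] --> P v (stays X 0 u G).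
  move=> cG; have mG := measurable_stays (lexx 0) u0 cG.
  have mGn n : measurable (stays X (u / n.+2%:R) u G).
    by case/andP: (un n) => ? ?; apply: measurable_stays_pos.
  rewrite stays_from_zero// in mG *; apply: nonincreasing_cvg_mu => //.
    exact: probability_lty.
  move=> m n mn; apply/subsetPset => w wG r /andP[nr ru]; apply: wG.
  rewrite ru andbT; apply: le_trans nr; rewrite ler_pM2l// lef_pV2 ?posrE//.
  by rewrite ler_nat.
rewrite -(cvg_lim _ (Plim (y + b) F cF))// -(cvg_lim _ (Plim y _ cFb))//.
congr (lim (_ @ \oo)); apply/funext => n.
by case/andP: (un n) => ? ?; exact: pos.
Qed.

Lemma measurable_stays_open s u U : 0 <= s -> s < u -> open U ->
  measurable (stays X s u U).
Proof.
move=> s0 su oU; have -> : stays X s u U = stays X s u setT `&` stays X s u U.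
  by rewrite setIidr.
rewrite (stays_open_exhaust brownian_continuous)//.
apply: bigcupT_measurable => n; apply: measurable_stays => //.
by rewrite setTI; exact: closed_inner_part.
Qed.

Lemma inner_stays_cvg y s u A U : 0 <= s -> s < u -> closed A -> open U ->
  P y (stays X s u (A `&` inner_part U n.+1%:R^-1)) @[n --> \oo] -->
  P y (stays X s u A `&` stays X s u U).
Proof.
move=> s0 su cA oU.
have mn n : measurable (stays X s u (A `&` inner_part U n.+1%:R^-1)).
  by apply: measurable_stays => //; apply: closedI => //; exact: closed_inner_part.
rewrite (stays_open_exhaust brownian_continuous)//.
apply: nondecreasing_cvg_mu => //.
  exact: bigcupT_measurable.
move=> m n mn'; apply/subsetPset; apply: staysS; apply: setIS.
by apply: inner_partS; rewrite lef_pV2 ?posrE// ler_nat.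
Qed.

Lemma inner_exits_cvg y s u A U : 0 <= s -> s < u -> closed A -> open U ->
  P y (stays X s u A `\` stays X s u (A `&` inner_part U n.+1%:R^-1))
    @[n --> \oo] -->
  P y (stays X s u A `\` stays X s u U).
Proof.
move=> s0 su cA oU; have mA := measurable_stays s0 su cA.
have mU := measurable_stays_open s0 su oU.
have mn n : measurable (stays X s u (A `&` inner_part U n.+1%:R^-1)).
  by apply: measurable_stays => //; apply: closedI => //; exact: closed_inner_part.
have mD n : measurable
    (stays X s u A `\` stays X s u (A `&` inner_part U n.+1%:R^-1)).
  exact: measurableD.
have -> : stays X s u A `\` stays X s u U = \bigcap_n
    (stays X s u A `\` stays X s u (A `&` inner_part U n.+1%:R^-1)).
  have exhaust := stays_open_exhaust brownian_continuous u A oU s0.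
  apply/seteqP; split => w.
    move=> [wA wU] n _; split => // wn; apply: wU.
    have : (\bigcup_n stays X s u (A `&` inner_part U n.+1%:R^-1)) w by exists n.
    by rewrite -exhaust => -[].
  move=> wn; have wA : stays X s u A w by have [] := wn 0%N Logic.I.
  split => // wU; have : (stays X s u A `&` stays X s u U) w by [].
  by rewrite exhaust => -[n _ wn']; have [] := wn n Logic.I.
apply: nonincreasing_cvg_mu => //.
- exact: probability_lty.
- exact: bigcapT_measurable.
- move=> m n mn'; apply/subsetPset; apply: setDS; apply: staysS; apply: setIS.
  by apply: inner_partS; rewrite lef_pV2 ?posrE// ler_nat.
Qed.

(** The translation by [a] is performed one coordinate at a time; [m] bounds
    the number of coordinates still to be moved. *)
Lemma brownian_quasi_invariance (t e : R) : 0 < t -> 0 < e ->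
  exists2 dl : R, 0 < dl &
  forall y a (tau : nat -> R) (n : nat) (E : set Omega),
    (forall i, `|a 0 i| <= 1) ->
    tau 0%N = 0 -> (forall k, tau k < tau k.+1) -> tau 1%N = t ->
    <<s rectangles (@first_position R d dsp Omega X tau n.+1) >> E ->
    (P (y + a)%R E <= dl%:E -> P y E <= e%:E)%E.
Proof.
move=> t0 e0.
suff /(_ d)[dl dl0 H] : forall m, exists2 dl : R, 0 < dl &
    forall y a (tau : nat -> R) (n : nat) (E : set Omega),
    (forall i, `|a 0 i| <= 1) -> (forall i : 'I_d, (m <= i)%N -> a 0 i = 0) ->
    tau 0%N = 0 -> (forall k, tau k < tau k.+1) -> tau 1%N = t ->
    <<s rectangles (@first_position R d dsp Omega X tau n.+1) >> E ->
    (P (y + a)%R E <= dl%:E -> P y E <= e%:E)%E.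
  exists dl => // y a tau n E a1; apply: H => // i.
  by rewrite leqNgt ltn_ord.
elim=> [|m [dl dl0 IH]].
  exists e => // y a tau n E _ am _ _ _ _.
  have -> : a = 0 by apply/rowP => i; rewrite am// mxE.
  by rewrite addr0.
have [dl' dl'0 one] := one_coordinate_quasi_invariance hX t0 dl0.
exists (Num.min dl dl'); first by rewrite lt_min dl0.
move=> y a tau n E a1 am tau0 tauS taut sE; rewrite minEle.
have [dm|md] := leqP d m.
  move=> PE; apply: IH sE _ => //.
    by move=> i mi; move: (ltn_ord i); rewrite ltnNge (leq_trans dm mi).
  by apply: le_trans PE _; rewrite lee_fin -minEle ge_min lexx.
pose i0 := Ordinal md.
pose a' : 'rV[R]_d := \row_i if i == i0 then 0 else a 0 i.
have -> : y + a = (y + a') + a 0 i0 *: delta_mx 0 i0.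
  apply/rowP => i; rewrite !mxE eqxx/= -addrA; congr (_ + _).
  by case: eqP => [->|_]; rewrite ?mulr1 ?mulr0 ?add0r ?addr0.
rewrite -minEle => PE.
have {PE} : (P (y + a' + a 0 i0 *: delta_mx 0 i0)%R E <= dl'%:E)%E.
  by apply: le_trans PE _; rewrite lee_fin ge_min lexx orbT.
move=> /(one _ _ _ _ _ _ (a1 i0) tau0 tauS taut sE).
apply: IH sE => //.
- by move=> i; rewrite mxE; case: eqP => // _; rewrite normr0.
- move=> i mi; rewrite mxE; case: eqP => // ii0; apply: am.
  rewrite ltn_neqAle mi andbT; apply/eqP => mi'.
  by apply: ii0; apply/val_inj.
Qed.

End brownian_paths.

(** * The boundary is not touched from inside *)

Lemma cvg_lt_eventually {R : realType} (f : nat -> \bar R) (l c : \bar R) :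
  f n @[n --> \oo] --> l -> (l < c)%E ->
  exists n0, forall n, (n0 <= n)%N -> (f n < c)%E.
Proof.
by move=> fl /open_ereal_lt' /fl [n0 _ H]; exists n0 => n /H.
Qed.

Section null_events.
Context {R : realType} {d : nat} {dsp : measure_display}
  {Omega : measurableType dsp}.
Variables (P : 'rV[R]_d -> probability Omega R) (X : R -> Omega -> 'rV[R]_d).
Hypothesis hX : brownian_family P X.
Implicit Types (y a b z xi : 'rV[R]_d) (A D U : set 'rV[R]_d) (s u : R).

Definition exits_within s u A U : set Omega := stays X s u A `\` stays X s u U.

Lemma measurable_exits_within s u A U : 0 <= s -> s < u -> closed A -> open U ->
  measurable (exits_within s u A U).
Proof.
move=> s0 su cA oU; apply: measurableD; first exact: (measurable_stays hX).
exact: (measurable_stays_open hX).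
Qed.

Lemma open_translate b U : open U -> open [set z | U (z + b)].
Proof.
move=> oU; rewrite -closedC.
have -> : ~` [set z | U (z + b)] = [set z | (~` U) (z + b)] by [].
by apply: closed_translate; rewrite closedC.
Qed.

Lemma exits_within_translate y b s u A U :
  0 <= s -> s < u -> closed A -> open U ->
  P (y + b) (exits_within s u A U) =
  P y (exits_within s u [set z | A (z + b)] [set z | U (z + b)]).
Proof.
move=> s0 su cA oU; have cAb := closed_translate (b := b) cA.
have oUb := open_translate (b := b) oU.
have lim1 := inner_exits_cvg hX (y := y + b) s0 su cA oU.
have lim2 := inner_exits_cvg hX (y := y) s0 su cAb oUb.
rewrite /exits_within -(cvg_lim _ lim1)// -(cvg_lim _ lim2)//.
congr (lim (_ @ \oo)); apply/funext => n.
have cI V G : closed G -> closed (G `&` inner_part V n.+1%:R^-1).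
  by move=> cG; apply: closedI => //; exact: closed_inner_part.
have mst F : closed F -> measurable (stays X s u F).
  exact: (measurable_stays hX).
have fin v F : closed F -> (P v (stays X s u F) < +oo)%E.
  by move=> cF; apply: probability_lty; exact: mst.
rewrite measureD; [|exact: mst|by apply: mst; exact: cI|exact: fin].
rewrite measureD; [|exact: mst|by apply: mst; exact: cI|exact: fin].
have sI V G : stays X s u G `&` stays X s u (G `&` inner_part V n.+1%:R^-1) =
    stays X s u (G `&` inner_part V n.+1%:R^-1).
  by rewrite setIidr//; apply: staysS => z [].
rewrite !sI; congr (_ - _)%E; first exact: (stays_translate hX).
rewrite -inner_part_translate.
by apply: (stays_translate hX) => //; exact: cI.
Qed.

(** The bounds of [brownian_quasi_invariance] are uniform in the grid, so they
    survive the passage to the limit along the dyadic grids, applied to the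
    closed sets [A] and [B n], where [B n] increases to [A `&` U]. *)
Lemma exits_within_quasi_invariance s u e : 0 < s -> s < u -> 0 < e ->
  exists2 dl : R, 0 < dl & forall y a A U, closed A -> open U ->
    (forall i, `|a 0 i| <= 1) ->
    (P (y + a)%R (exits_within s u A U) < dl%:E ->
     P y (exits_within s u A U) <= e%:E)%E.
Proof.
move=> s0 su e0; have [dl dl0 qi] := brownian_quasi_invariance hX s0 e0.
exists dl => // y a A U cA oU a1 Pdl.
pose B n := A `&` inner_part U n.+1%:R^-1.
have cB n : closed (B n) by apply: closedI => //; exact: closed_inner_part.
have mst F : closed F -> measurable (stays X s u F).
  by apply: (measurable_stays hX) => //; exact: ltW.
pose E (G : set 'rV[R]_d) k : set Omega :=
  stays_on_grid X (dyadic_grid s u k) (2 ^ k).+1 G.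
have tauS k := dyadic_gridS k _ s0 su.
have mE G k : closed G -> measurable (E G k).
  by move=> cG; apply: (stays_on_grid_measurable hX).
have fine_E v n k : P v (E A k `\` E (B n) k) = (P v (E A k) - P v (E (B n) k))%E.
  rewrite measureD; [|exact: mE|exact: mE|by apply: probability_lty; exact: mE].
  by rewrite setIidr// => w wB j; have [] := wB j.
have diff_E v n : P v (E A k `\` E (B n) k) @[k --> \oo] -->
    P v (stays X s u A `\` stays X s u (B n)).
  rewrite measureD; [|exact: mst|exact: mst|by apply: probability_lty; exact: mst].
  rewrite setIidr; last by apply: staysS => z [].
  under eq_fun do rewrite fine_E.
  apply: cvgeB; [|exact: (on_grid_cvg hX)|exact: (on_grid_cvg hX)].
  by apply: fin_num_adde_defr; apply: fin_num_measure; exact: mst.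
have lim_exit v := inner_exits_cvg hX (y := v) (ltW s0) su cA oU.
have fm v F : measurable F -> P v F \is a fin_num.
  by move=> mF; apply: fin_num_measure.
have mD n : measurable (stays X s u A `\` stays X s u (B n)).
  by apply: measurableD; exact: mst.
have [n Pn] : exists n,
    (P (y + a) (stays X s u A `\` stays X s u (B n)) < dl%:E)%E.
  have [n0 /(_ n0 (leqnn n0)) ?] := cvg_lt_eventually (lim_exit (y + a)) Pdl.
  by exists n0.
apply: (@le_trans _ _ (P y (stays X s u A `\` stays X s u (B n)))).
  apply: le_measure; rewrite ?inE//.
    by apply: measurable_exits_within => //; exact: ltW.
  move=> w [wA wU]; split => // wB; apply: wU; apply: staysS wB => z [_].
  by apply: inner_part_sub; rewrite invr_gt0.
have [k0 Pk] := cvg_lt_eventually (diff_E (y + a) n) Pn.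
apply: (cvge_le _ (diff_E y n)); exists k0 => // k /= /Pk/ltW.
apply: (qi y a (dyadic_grid s u k) (2 ^ k)%N) => //.
  by rewrite /= mulr0 mul0r addr0.
have sE G : closed G -> <<s rectangles (@first_position R d dsp Omega X
    (dyadic_grid s u k) (2 ^ k).+1) >> (E G k).
  by move=> cG; apply: stays_on_grid_sigma.
pose GT := g_sigma_algebraType (rectangles (@first_position R d dsp Omega X
    (dyadic_grid s u k) (2 ^ k).+1)).
by apply: (@measurableD _ GT); exact: sE.
Qed.

End null_events.

Section no_touching.
Context {R : realType} {d : nat} {dsp : measure_display}
  {Omega : measurableType dsp}.
Variables (P : 'rV[R]_d -> probability Omega R) (X : R -> Omega -> 'rV[R]_d).
Hypothesis hX : brownian_family P X.
Implicit Types (y a b z xi : 'rV[R]_d) (A D U : set 'rV[R]_d) (s u : R).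

Lemma exits_within_disjoint A U xi s u h1 h2 :
  (forall z, A z -> U (z + (h2 - h1) *: xi)) ->
  exits_within X s u [set z | A (z + h1 *: xi)] [set z | U (z + h1 *: xi)] `&`
  exits_within X s u [set z | A (z + h2 *: xi)] [set z | U (z + h2 *: xi)] = set0.
Proof.
move=> AU; apply/seteqP; split => // w [[w1 _] [_]]; apply => r rsu /=.
have := AU _ (w1 r rsu); rewrite /= -addrA -scalerDl.
by have -> : h1 + (h2 - h1) = h2 by ring.
Qed.

(** Pairwise disjoint events cannot all have probability at least [dl], so for
    some [j] the event translated by [h j *: xi] has probability less than [dl].
    By quasi-invariance the event itself has probability at most [e]. *)
Lemma exits_within_null A U xi h0 y s u : closed A -> open U -> 0 < h0 ->
  (forall i, `|xi 0 i| <= 1) ->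
  (forall z h, A z -> 0 < h < h0 -> U (z + h *: xi)) ->
  0 < s -> s < u -> P y (exits_within X s u A U) = 0%E.
Proof.
move=> cA oU h0_gt0 xi1 AU s0 su.
have mE : measurable (exits_within X s u A U).
  by apply: (measurable_exits_within hX) => //; exact: ltW.
apply/eqP; rewrite -measure_le0; apply/lee_addgt0Pr => e e0; rewrite add0e.
have [dl dl0 qi] := exits_within_quasi_invariance hX s0 su e0.
(* The bound by 1 keeps the coordinates of [h j *: xi] in [-1, 1], the range
   of the translations allowed by quasi-invariance. *)
pose h (j : nat) := Num.min h0 1 / j.+2%:R.
have hmin : 0 < Num.min h0 1 by rewrite lt_min h0_gt0/=.
have h_gt0 j : 0 < h j by rewrite divr_gt0.
have h_decr i j : (i < j)%N -> h j < h i.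
  by move=> ij; rewrite ltr_pM2l// ltf_pV2 ?posrE// ltr_nat !ltnS.
have h_lt j : h j < Num.min h0 1.
  by rewrite /h ltr_pdivrMr// ltr_pMr// ltr1n.
pose G j := exits_within X s u
  [set z | A (z + h j *: xi)] [set z | U (z + h j *: xi)].
have mG j : measurable (G j).
  apply: (measurable_exits_within hX) => //; first exact: ltW.
    exact: closed_translate.
  exact: open_translate.
have tG : trivIset setT G.
  suff H i j : (i < j)%N -> G j `&` G i = set0.
    apply/trivIsetP => i j _ _; rewrite neq_lt => /orP[/H|/H //].
    by rewrite setIC.
  move=> ij; apply: exits_within_disjoint => z Az; apply: AU => //.
  rewrite subr_gt0 h_decr//=; have := h_lt i; rewrite lt_min => /andP[hi _].
  by apply: lt_trans hi; rewrite ltrBlDr ltrDl.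
have [j Gj] : exists j, (P y (G j) < dl%:E)%E.
  apply: contrapT => /forallNP noG.
  pose N := Num.bound (dl^-1).
  have : (P y (\big[setU/set0]_(j < N) G j) <= 1)%E.
    by apply: probability_le1; exact: bigsetU_measurable.
  rewrite measure_bigsetU// leNgt => /negP; apply.
  apply: (@lt_le_trans _ _ (\sum_(j < N) dl%:E)%E).
    rewrite sumEFin sumr_const card_ord -mulr_natl lte_fin -ltr_pdivrMr// div1r.
    by apply: archi_boundP; rewrite invr_ge0 ltW.
  by apply: lee_sum => j _; rewrite leNgt; apply/negP; exact: noG.
apply: (qi y (h j *: xi)) => //.
  move=> i; rewrite !mxE normrM -[leRHS]mulr1 ler_pM//.
  by have := h_lt j; rewrite lt_min gtr0_norm// => /andP[_ /ltW].
by rewrite (exits_within_translate hX) //; exact: ltW.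
Qed.

(** If the path touches the boundary at time [r], then [r > 0], and a rational
    time interval around [r], cut at [t], is short enough for the path to remain
    in one of finitely many balls that cover the boundary.  The resulting events
    are countably many, and null by [exits_within_null]. *)
Lemma boundary_not_touched D (rho h0 t : R) y :
  open D -> compact (closure D) -> 0 < rho -> 0 < h0 -> 0 < t -> D y ->
  (forall x0, boundary D x0 -> exists xi, (forall i, `|xi 0 i| <= 1) /\
     forall z h, closure D z -> `|x0 - z| <= rho -> 0 < h < h0 ->
       D (z + h *: xi)) ->
  P y (exits_within X 0 t (closure D) D) = 0%E.
Proof.
move=> oD cD rho0 h0_gt0 t0 Dy bD.
have D_interior : D° = D by apply/interior_id.
have bDE : boundary D = closure D `\` D by rewrite /boundary D_interior.
have cbD : compact (boundary D).
  apply: subclosed_compact cD _; last by rewrite bDE => z [].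
  by rewrite bDE setDE; apply: closedI; [exact: closed_closure|rewrite closedC].
have [s bs] : exists s : seq 'rV[R]_d, forall z, boundary D z ->
    exists j : nat, ball (nth 0 s j) rho z /\ boundary D (nth 0 s j).
  move: cbD; rewrite compact_cover.
  move=> /(_ _ (boundary D) (fun x0 => ball x0 rho)) [].
  - by move=> x0 _; exact: ball_open.
  - by move=> z bz; exists z => //; exact: ballxx.
  move=> F FbD cover; exists (finmap.enum_fset F) => z /cover[x0 /= x0F zx0].
  exists (index x0 (finmap.enum_fset F)); rewrite nth_index//.
  by split => //; have := FbD _ x0F; rewrite inE.
pose q (n : nat) : R := ratr (odflt 0 (unpickle n : option rat)).
pose B j := closure D `&` closed_ball_ Num.norm (nth 0 s j) rho.
pose E j m n : set Omega :=
  if `[< boundary D (nth 0 s j) /\ 0 < q m < Num.min t (q n) >]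
  then exits_within X (q m) (Num.min t (q n)) (B j) D else set0.
have E_null j m n : (P y).-negligible (E j m n).
  rewrite /E; case: asboolP => [[bj /andP[qm0 qmn]]|_]; last exact: negligible_set0.
  have cB : closed (B j).
    by apply: closedI; [exact: closed_closure|exact: closed_closed_ball_].
  apply/negligibleP.
    by apply: (measurable_exits_within hX) => //; exact: ltW.
  have [xi [xi1 Dxi]] := bD _ bj.
  apply: (exits_within_null (xi := xi) (h0 := h0)) => // z h [Dz zj].
  exact: Dxi.
have start_null : (P y).-negligible (~` [set w | X 0 w = y]).
  have mS := measurable_brownian_start hX y.
  have PS : P y (~` [set w | X 0 w = y]) = 0%E.
    by rewrite probability_setC// (brownian_start hX) subee.
  by apply/negligibleP; [exact: measurableC|exact: PS].
apply: measure_negligible.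
  by apply: (measurable_exits_within hX) => //; exact: closed_closure.
apply: (negligibleS (A := ~` [set w | X 0 w = y] `|`
  \bigcup_j \bigcup_m \bigcup_n E j m n)); last first.
  apply: negligibleU start_null _.
  by apply: negligible_bigcup => j; apply: negligible_bigcup => m;
    apply: negligible_bigcup => n.
move=> w [wD wnD]; have [wy|] := pselect (X 0 w = y); [right|by left].
have [r [r0 rt rD]] : exists r, [/\ 0 <= r, r <= t & ~ D (X r w)].
  apply: contrapT => /forallNP H; apply: wnD => r /andP[r0 rt].
  by apply: contrapT => rD; apply: (H r).
have r_gt0 : 0 < r.
  by rewrite lt_neqAle r0 andbT; apply/eqP => r0E; apply: rD; rewrite -r0E wy.
have bXr : boundary D (X r w).
  by rewrite bDE; split => //; apply: wD; rewrite r0.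
have [j [jr bj]] := bs _ bXr.
have /nbhs_ballP[e /= e0 eB] : nbhs (X r w) (ball (nth 0 s j) rho).
  by apply: open_nbhs_nbhs; split => //; exact: ball_open.
have [dl dl0 dlX] := path_continuous (brownian_continuous hX) w r0 e0.
have /rat_in_itvoo[q1] : Num.max 0 (r - dl) < r.
  by rewrite gt_max r_gt0 ltrBlDr ltrDl.
rewrite in_itv/= gt_max => /andP[/andP[q10 q1l] q1r].
have /rat_in_itvoo[q2] : r < r + dl by rewrite ltrDl.
rewrite in_itv/= => /andP[q2r q2l].
have qK (p : rat) : q (pickle p) = ratr p by rewrite /q pickleK.
exists j => //; exists (pickle q1) => //; exists (pickle q2) => //.
rewrite /E !qK ifT; last first.
  apply/asboolP; split => //; rewrite q10 lt_min (lt_le_trans q1r rt)/=.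
  exact: lt_trans q2r.
have inE' v : ratr q1 <= v <= Num.min t (ratr q2) -> B j (X v w).
  rewrite le_min => /andP[q1v /andP[vt vq2]].
  have v0 : 0 <= v by apply: le_trans q1v; exact: ltW.
  split; first by apply: wD; rewrite v0.
  have := eB _ (dlX v v0 _); rewrite -ball_normE/= => H; apply: ltW; apply: H.
  rewrite ltr_norml; apply/andP; split.
    by rewrite ltrBrDl; apply: lt_le_trans q1v.
  by rewrite ltrBlDl; apply: le_lt_trans q2l.
split; first exact: inE'.
by move=> H; apply: rD; apply: H; rewrite le_min (ltW q1r) rt ltW.
Qed.

End no_touching.

(** * Geometry of the cone property *)

Section euclidean_geometry.
Context {R : realType} {d : nat}.
Implicit Types (x y z v xi : 'rV[R]_d) (D : set 'rV[R]_d) (eps h rho dl : R).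

Lemma norm_le_coord z rho : 0 <= rho -> (forall i, `|z 0 i| <= rho) -> `|z| <= rho.
Proof.
move=> rho0 zr; rewrite /Num.norm/= mx_normrE; apply/bigmax_leP; split => //.
by move=> [i j] _; rewrite ord1.
Qed.

Lemma coord_le_norm z i : `|z 0 i| <= `|z|.
Proof.
rewrite [leRHS]/Num.norm/= mx_normrE.
exact: (le_bigmax _ (fun ij : 'I_1 * 'I_d => `|z ij.1 ij.2|) (0, i)).
Qed.

Lemma edot_ge0 z : 0 <= edot z z.
Proof. by apply: sumr_ge0 => i _; rewrite -expr2 sqr_ge0. Qed.

Lemma coord_le_enorm z i : `|z 0 i| <= enorm z.
Proof.
rewrite -sqrtr_sqr ler_sqrt ?edot_ge0// /edot (bigD1 i)//= -expr2 lerDl.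
by apply: sumr_ge0 => j _; rewrite -expr2 sqr_ge0.
Qed.

Lemma norm_le_enorm z : `|z| <= enorm z.
Proof. by apply: norm_le_coord => [|i]; rewrite ?sqrtr_ge0// coord_le_enorm. Qed.

Lemma edot_norm_le x y b : (forall i, `|y 0 i| <= b) ->
  `|edot x y| <= d%:R * (`|x| * b).
Proof.
move=> yb; apply: le_trans (ler_norm_sum _ _ _) _.
rewrite -[d in d%:R]card_ord mulr_natl -sumr_const.
by apply: ler_sum => i _; rewrite normrM ler_pM// coord_le_norm.
Qed.

Lemma enorm_le_norm z : enorm z <= d%:R * `|z|.
Proof.
case: (posnP d) => [d0|d_gt0].
  rewrite /enorm /edot big1 ?sqrtr0 ?mulr_ge0// => i _.
  by have := ltn_ord i; rewrite [X in (_ < X)%N]d0.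
rewrite -(@ger0_norm _ (d%:R * `|z|)) ?mulr_ge0// -sqrtr_sqr ler_sqrt ?sqr_ge0//.
apply: le_trans (ler_norm _) _.
apply: le_trans (edot_norm_le z (coord_le_norm z)) _.
rewrite exprMn -expr2 ler_wpM2r ?sqr_ge0// expr2 ler_peMl// ?ler1n//.
Qed.

Lemma edot_expand y z h xi :
  edot (h *: xi + z) y = h * edot xi y + edot z y.
Proof.
rewrite /edot mulr_sumr -big_split/=; apply: eq_bigr => i _.
by rewrite !mxE mulrDl mulrA.
Qed.

Lemma edotC x y : edot x y = edot y x.
Proof. by apply: eq_bigr => i _; rewrite mulrC. Qed.

(** As [cos eps < 1], the axis of the cone is in its interior, and by
    homogeneity the cone contains a ball of radius proportional to [h] around
    the point of the axis at distance [h] from the vertex. *)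
Lemma cone_contains_ball eps : 0 < eps -> cos eps != 1 ->
  exists2 k : R, 0 < k <= 1 & forall y xi v h, enorm xi = 1 -> 0 < h < eps / 2 ->
    `|v| <= k * h -> cone y xi eps (y + (h *: xi + v)).
Proof.
move=> eps0 cos1; pose c := Num.max (cos eps) 0.
have c1 : c < 1 by rewrite gt_max ltr01 lt_neqAle cos1 cos_le1.
have c0 : 0 <= c by rewrite le_max lexx orbT.
have d0 : 0 < d.+1%:R :> R by rewrite ltr0n.
(* The factor [1 / d.+1] compares the Euclidean norm with the sup norm.  The
   Euclidean norm of [v] is then at most some [q <= (1 - c) * h / 4], which
   gives [c * (h + q) <= h - q] and the angular condition for [h *: xi + v]. *)
exists ((1 - c) / (4 * d.+1%:R)).
  rewrite divr_gt0 ?mulr_gt0 ?subr_gt0//= ler_pdivrMr ?mulr_gt0// mul1r.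
  by have : 1 <= d.+1%:R :> R by [rewrite ler1n]; nra.
move=> y xi v h xi1 /andP[h0 heps] vh.
have xixi : edot xi xi = 1.
  by rewrite -(sqr_sqrtr (edot_ge0 xi)) -/(enorm xi) xi1 expr1n.
pose q := d%:R * `|v|.
have q0 : 0 <= q by rewrite mulr_ge0.
have qh : q <= (1 - c) * h / 4.
  apply: (@le_trans _ _ (d.+1%:R * `|v|)); first by rewrite ler_wpM2r// ler_nat.
  rewrite -ler_pdivlMl//; apply: le_trans vh _.
  by rewrite le_eqVlt; apply/orP; left; apply/eqP; field; rewrite gt_eqF.
have vxi : `|edot v xi| <= q.
  apply: le_trans (edot_norm_le v (b := 1) _) _; last by rewrite mulr1.
  by move=> i; rewrite -xi1 coord_le_enorm.
have vv : edot v v <= q ^+ 2.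
  rewrite -(sqr_sqrtr (edot_ge0 v)) ler_pXn2r ?nnegrE ?sqrtr_ge0//.
  exact: enorm_le_norm.
have vv0 := edot_ge0 v.
move: vxi; rewrite ler_norml => /andP[vxi1 vxi2].
have E2 : edot (h *: xi + v) (h *: xi + v) = h ^+ 2 + h * edot v xi *+ 2 + edot v v.
  rewrite edot_expand (edotC xi) (edotC v) !edot_expand xixi (edotC xi v).
  by rewrite mulr1; ring.
have E_le : enorm (h *: xi + v) <= h + q.
  have hq0 : 0 <= h + q by rewrite addr_ge0// ltW.
  rewrite -[leRHS]ger0_norm// -sqrtr_sqr ler_sqrt ?sqr_ge0//.
  by rewrite E2; nra.
rewrite /cone/= addrAC subrr add0r; split.
  rewrite edot_expand xixi mulr1.
  apply: (@le_trans _ _ (c * enorm (h *: xi + v))).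
    by rewrite ler_wpM2r ?sqrtr_ge0// le_max lexx.
  by apply: le_trans (_ : c * (h + q) <= _); [rewrite ler_wpM2l|nra].
apply/andP; split; last by apply: le_lt_trans E_le _; nra.
by rewrite sqrtr_gt0 E2; nra.
Qed.

Lemma cone_property_shift eps D : 0 < eps -> cos eps != 1 -> cone_property eps D ->
  forall x0, boundary D x0 -> exists xi, (forall i, `|xi 0 i| <= 1) /\
    forall z h, closure D z -> `|x0 - z| <= eps / (2 * d.+1%:R) ->
      0 < h < eps / 2 -> D (z + h *: xi).
Proof.
move=> eps0 cos1 cD x0 /cD[xi [xi1 Dxi]]; exists xi; split.
  by move=> i; rewrite -xi1 coord_le_enorm.
have [k /andP[k0 _] kP] := cone_contains_ball eps0 cos1.
have d0 : 0 < d.+1%:R :> R by rewrite ltr0n.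
move=> z h Dz zx0 /[dup] heps /andP[h0 _]; apply: (Dxi z).
  split => //; rewrite /eball/=; apply: le_lt_trans (enorm_le_norm _) _.
  rewrite distrC; apply: (@le_lt_trans _ _ (d.+1%:R * (eps / (2 * d.+1%:R)))).
    by apply: ler_pM => //; rewrite ler_nat.
  rewrite (_ : _ * _ = eps / 2) ?ltr_pdivrMr//; first by lra.
  by field; rewrite gt_eqF.
rewrite -[h *: xi]addr0; apply: kP => //.
by rewrite normr0 mulr_ge0// ltW.
Qed.

(** The point is the first one on the segment from [y] to [z] that is not in
    [D]. *)
Lemma boundary_on_segment D y z : open D -> D y -> ~ D z ->
  exists2 x, boundary D x & `|x - z| <= `|y - z|.
Proof.
move=> oD Dy Dz.
pose f (l : R) := y + l *: (z - y).
have fB l l' : f l - f l' = (l - l') *: (z - y).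
  by rewrite /f opprD addrACA subrr add0r scalerBl.
have f_norm l l' : `|f l - f l'| = `|l - l'| * `|z - y| by rewrite fB normrZ.
pose L : set R := [set l | 0 <= l <= 1 /\ ~ D (f l)].
have f1 : f 1 = z by rewrite /f scale1r addrC subrK.
have f0 : f 0 = y by rewrite /f scale0r addr0.
have L1 : L 1 by split; rewrite ?ler01 ?lexx ?f1.
have Lb : lbound L 0 by move=> l [/andP[]].
have hL : has_inf L by split; [exists 1|exists 0].
pose l0 := inf L.
have l0_ge0 : 0 <= l0 by apply: lb_le_inf => //; exists 1.
have l0_le1 : l0 <= 1 by apply: ge_inf => //; exists 0.
have zy1 : 0 < `|z - y| + 1 by rewrite ltr_wpDl.
have near_f l e : 0 < e -> `|l - l0| < e / (`|z - y| + 1) -> ball (f l0) e (f l).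
  move=> e0; rewrite ltr_pdivlMr// -ball_normE/= distrC f_norm => le.
  by apply: le_lt_trans le; rewrite ler_wpM2l// lerDl.
have nDl0 : ~ D (f l0).
  move=> Dl0.
  have /nbhs_ballP[e /= e0 eD] : nbhs (f l0) D by exact: open_nbhs_nbhs.
  have e'0 : 0 < e / (`|z - y| + 1) by rewrite divr_gt0.
  have [l [/andP[l0' l1] nDl] ll0] := inf_adherent e'0 hL.
  have l0l : l0 <= l.
    by apply: ge_inf; [exists 0|split => //; apply/andP; split].
  apply: nDl; apply: eD; apply: near_f => //.
  by rewrite ger0_norm ?subr_ge0// ltrBlDl.
have l0_gt0 : 0 < l0.
  rewrite lt_neqAle l0_ge0 andbT; apply/eqP => l00.
  by apply: nDl0; rewrite -l00 f0.
exists (f l0); last first.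
  rewrite -f1 f_norm (_ : `|y - f 1| = `|z - y|); last by rewrite f1 distrC.
  by rewrite ler_piMl// ler_norml; apply/andP; split; lra.
split; last by move/interior_subset.
move=> V /nbhs_ballP[e /= e0 eV].
pose l := Num.max 0 (l0 - e / (`|z - y| + 1) / 2).
have e'0 : 0 < e / (`|z - y| + 1) by rewrite divr_gt0.
have ll0 : l < l0 by rewrite gt_max l0_gt0/= ltrBlDr ltrDl divr_gt0.
have l_ge : l0 - e / (`|z - y| + 1) / 2 <= l by rewrite le_max lexx orbT.
have l_ge0 : 0 <= l by rewrite le_max lexx.
exists (f l); split.
  apply: contrapT => nDl; move: (ll0); apply/negP; rewrite -leNgt.
  apply: ge_inf; first by exists 0.
  by split => //; rewrite l_ge0 (le_trans (ltW ll0)).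
apply: eV; apply: near_f => //; rewrite ltr0_norm ?subr_lt0//.
by move: e'0 l_ge; set w := e / _ => ? ?; lra.
Qed.

(** Suppose that [z] in [inner_part D2 rho] is not in [D1].  By density there is
    a boundary point [x] of [D1] near [z]; let [xi] be its cone direction.  The
    point [x - s *: xi] is still in [D2], so [D1] has a point [y] near it, and
    [x] is in the cone at [y], hence in the open set [D1]. *)
Lemma cone_property_fills eps rho : 0 < eps -> cos eps != 1 -> 0 < rho ->
  exists2 dl, 0 < dl & forall D1 D2, open D1 -> cone_property eps D1 ->
    (forall p, D2 p -> exists2 y, D1 y & `|p - y| < dl) ->
    inner_part D2 rho `<=` D1.
Proof.
move=> eps0 cos1 rho0.
have [k /andP[k0 k1] kP] := cone_contains_ball eps0 cos1.
have d0 : 0 < d.+1%:R :> R by rewrite ltr0n.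
(* The first bound keeps [x - s *: xi] in [D2], the second keeps [y] in the
   Euclidean ball around [x] in which the cone direction is valid. *)
pose s := Num.min (rho / 2) (eps / (4 * d.+1%:R)).
have s0 : 0 < s by rewrite lt_min !divr_gt0// mulr_gt0.
have s_rho : s <= rho / 2 by rewrite ge_min lexx.
have s_eps : s * (4 * d.+1%:R) <= eps.
  by rewrite -ler_pdivlMr ?mulr_gt0// ge_min lexx orbT.
have d1 : 1 <= d.+1%:R :> R by rewrite ler1n.
exists (k * s); first exact: mulr_gt0.
move=> D1 D2 oD1 cD1 dense z zD2; apply: contrapT => nD1z.
have [y0 D1y0 zy0] := dense z (inner_part_sub rho0 zD2).
have [x bx xz] := boundary_on_segment oD1 D1y0 nD1z.
have {}xz : `|x - z| < k * s by apply: le_lt_trans xz _; rewrite distrC.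
have ks : k * s <= s by rewrite ler_piMl// ltW.
have [xi [xi1 Dxi]] := cD1 x bx.
have xi_le1 : `|xi| <= 1 by rewrite -xi1 norm_le_enorm.
have sxi : `|s *: xi| <= s by rewrite normrZ gtr0_norm// ler_piMr// ltW.
have D2p : D2 (x - s *: xi).
  apply: contrapT => /zD2; apply/negP; rewrite -ltNge addrAC.
  by apply: le_lt_trans (ler_normB _ _) _; lra.
have [y D1y py] := dense _ D2p.
suff D1x : D1 x by case: bx => _; apply; rewrite (iffLR (interior_id D1) oD1).
have x_eq : x = y + (s *: xi + (x - s *: xi - y)) 
  by apply/rowP => i; rewrite !mxE; ring.
have yx : `|y - x| < 2 * s.
  have -> : y - x = - (s *: xi) - (x - s *: xi - y).
    by apply/rowP => i; rewrite !mxE; ring.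
  by apply: le_lt_trans (ler_normB _ _) _; rewrite normrN; lra.
apply: (Dxi y).
  split; first exact: subset_closure.
  rewrite /eball/=; apply: le_lt_trans (enorm_le_norm _) _.
  apply: (@le_lt_trans _ _ (d.+1%:R * (2 * s))).
    by apply: ler_pM => //; [rewrite ler_nat|exact: ltW].
  by nra.
rewrite [X in cone _ _ _ X]x_eq; apply: kP => //; last exact: ltW.
by rewrite s0/=; nra.
Qed.

Lemma hausdorff_dist_lt D1 D2 dl : (hausdorff_dist D1 D2 < dl%:E)%E ->
  (forall p, D1 p -> exists2 y, D2 y & `|p - y| < dl) /\
  (forall p, D2 p -> exists2 y, D1 y & `|p - y| < dl).
Proof.
suff H (A B : set 'rV[R]_d) : (ereal_sup [set Defs.edist x B | x in A] < dl%:E)%E ->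
    forall p, A p -> exists2 y, B y & `|p - y| < dl.
  by rewrite /hausdorff_dist gt_max => /andP[/H ? /H ?].
move=> supAB p Ap.
have : (Defs.edist p B < dl%:E)%E.
  by apply: le_lt_trans supAB; apply: ereal_sup_ubound; exists p.
move=> /ereal_inf_lt[_ [y By <-]]; rewrite lte_fin => py.
by exists y => //; apply: le_lt_trans (norm_le_enorm _) py.
Qed.

Lemma compact_closure_of_bounded D c rho :
  D `<=` eball c rho -> compact (closure D).
Proof.
move=> Dc; apply: bounded_closed_compact; last exact: closed_closure.
exists (`|c| + rho + 1); split; first exact: num_real.
move=> M MM z Dz; apply: ltW; apply: le_lt_trans MM.
have [v [/Dc]] := Dz _ (nbhsx_ballx z _ ltr01).
rewrite /eball/= => /(le_lt_trans (norm_le_enorm _)) vc.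
rewrite -ball_normE/= => zv.
have -> : z = c + (v - c) + (z - v) by apply/rowP => i; rewrite !mxE; ring.
apply: le_trans (ler_normD _ _) _; rewrite lerD ?(ltW zv)//.
by apply: le_trans (ler_normD _ _) _; rewrite lerD ?(ltW vc).
Qed.

End euclidean_geometry.

(** * Convergence of the survival probabilities *)

Section thickenings.
Context {R : realType} {d : nat}.
Implicit Types (D : set 'rV[R]_d) (z b : 'rV[R]_d) (dl : R).

(** A closed neighbourhood; the closure of the set of points at distance less
    than [dl] avoids any attainment question for the distance to [D]. *)
Definition thickening D dl : set 'rV[R]_d :=
  closure [set z | exists2 y, D y & `|z - y| < dl].

Lemma closed_thickening D dl : closed (thickening D dl).
Proof. exact: closed_closure. Qed.

Lemma thickening_near D dl z : 0 < dl -> thickening D dl z ->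
  exists2 y, D y & `|z - y| < 2 * dl.
Proof.
move=> dl0 zD; have [v [[y Dy vy]]] := zD _ (nbhsx_ballx z _ dl0).
rewrite -ball_normE/= => zv; exists y => //.
have -> : z - y = (z - v) + (v - y) by rewrite addrA subrK.
by apply: le_lt_trans (ler_normD _ _) _; lra.
Qed.

(** One [dl] for the translation and up to [2 * dl] for the closure. *)
Lemma thickening_move D dl z b : 0 < dl -> `|b| < dl -> thickening D dl (z + b) ->
  thickening D (3 * dl) z.
Proof.
move=> dl0 bdl /(thickening_near dl0)[y Dy zby]; apply: subset_closure.
exists y => //; have -> : z - y = (z + b - y) - b.
  by apply/rowP => i; rewrite !mxE; ring.
by apply: le_lt_trans (ler_normB _ _) _; lra.
Qed.

Lemma thickeningS D dl1 dl2 : dl1 <= dl2 -> thickening D dl1 `<=` thickening D dl2.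
Proof.
move=> le12; apply: closureS => z [y Dy zy]; exists y => //.
exact: lt_le_trans zy le12.
Qed.

Lemma closure_thickening D : closure D = \bigcap_n thickening D n.+1%:R^-1.
Proof.
apply/seteqP; split => [z|z zD].
  move=> + n _; apply: closureS => v Dv; exists v => //.
  by rewrite subrr normr0 invr_gt0.
move=> V /nbhs_ballP[e /= e0 eV].
have e20 : 0 < e / 2 by rewrite divr_gt0.
have [n _ /(_ n (leqnn n)) ne] := near_infty_natSinv_lt (PosNum e20).
have {}ne : n.+1%:R^-1 < e / 2 by exact: ne.
have [|y Dy zy] := thickening_near _ (zD n Logic.I); first by rewrite invr_gt0.
exists y; split => //; apply: eV; rewrite -ball_normE/=.
by move: ne zy; set q := _^-1 => ne zy; lra.
Qed.

End thickenings.

Section survival.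
Context {R : realType} {d : nat} {dsp : measure_display}
  {Omega : measurableType dsp}.
Variables (P : 'rV[R]_d -> probability Omega R) (X : R -> Omega -> 'rV[R]_d).
Hypothesis hX : brownian_family P X.

Lemma thickening_stays_cvg y t (D : set 'rV[R]_d) : 0 < t ->
  P y (stays X 0 t (thickening D n.+1%:R^-1)) @[n --> \oo] -->
  P y (stays X 0 t (closure D)).
Proof.
move=> t0; have mT n : measurable (stays X 0 t (thickening D n.+1%:R^-1)).
  by apply: (measurable_stays hX) => //; exact: closed_thickening.
have -> : stays X 0 t (closure D) =
    \bigcap_n stays X 0 t (thickening D n.+1%:R^-1).
  rewrite closure_thickening; apply/seteqP; split => w wD.
    by move=> n _ r /wD; exact.
  by move=> r rt n _; exact: wD.
apply: nonincreasing_cvg_mu => //.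
- exact: probability_lty.
- exact: bigcapT_measurable.
- move=> m n mn; apply/subsetPset; apply: staysS; apply: thickeningS.
  by rewrite lef_pV2 ?posrE// ler_nat.
Qed.

Lemma stays_closure_cone_property eps c r (D : set 'rV[R]_d) y t :
  0 < eps -> cos eps != 1 -> cone_class eps (eball c r) D -> D y -> 0 < t ->
  P y (stays X 0 t (closure D)) = P y (stays X 0 t D).
Proof.
move=> eps0 cos1 [[oD _ _] Dc coneD] Dy t0.
have mC : measurable (stays X 0 t (closure D)).
  by apply: (measurable_stays hX) => //; exact: closed_closure.
have mD : measurable (stays X 0 t D) by exact: (measurable_stays_open hX).
have null : P y (stays X 0 t (closure D) `\` stays X 0 t D) = 0%E.
  apply: (boundary_not_touched hX
    (rho := eps / (2 * d.+1%:R)) (h0 := eps / 2)) => //.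
  - exact: compact_closure_of_bounded Dc.
  - by rewrite divr_gt0// mulr_gt0.
  - by rewrite divr_gt0.
  - exact: cone_property_shift.
rewrite (measureDI (P y) mC mD) [X in (X + _)%E]null add0e setIidr//.
by apply: staysS; exact: subset_closure.
Qed.

End survival.

Theorem theorem1p4 (R : realType) (d : nat) (hd : (2 <= d)%N)
  (dsp : measure_display) (Omega : measurableType dsp)
  (P : 'rV[R]_d -> probability Omega R) (X : R -> Omega -> 'rV[R]_d)
  (hX : brownian_family P X)
  (eps : R) (heps : 0 < eps) (hcos : cos eps != 1)
  (c : 'rV[R]_d) (r : R) (hr : 0 < r)
  (D : nat -> set 'rV[R]_d) (D' : set 'rV[R]_d)
  (hD : forall m, cone_class eps (eball c r) (D m))
  (hD' : cone_class eps (eball c r) D')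
  (hH : hausdorff_dist (D m) D' @[m --> \oo] --> 0%E)
  (x : nat -> 'rV[R]_d) (x' : 'rV[R]_d)
  (hx : forall m, D m (x m)) (hx' : D' x')
  (hcvg : x m @[m --> \oo] --> x')
  (t : R) (ht : 0 < t) :
  P (x m) [set w | (t%:E < exit_time (X^~ w) (D m))%E] @[m --> \oo] -->
  P x' [set w | (t%:E < exit_time (X^~ w) D')%E].
Proof.
have oD m : open (D m) by have [[]] := hD m.
have oD' : open D' by have [[]] := hD'.
have survivalE y U : open U ->
    P y [set w | (t%:E < exit_time (X^~ w) U)%E] = P y (stays X 0 t U).
  move=> oU; congr (P y _); apply/seteqP; split => w;
    by move/(exit_timeP (brownian_continuous hX) w oU ht).
rewrite survivalE//; under eq_fun do rewrite survivalE//.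
have mst F : closed F -> measurable (stays X 0 t F).
  exact: (measurable_stays hX).
have msto U : open U -> measurable (stays X 0 t U).
  exact: (measurable_stays_open hX).
have translate m F : closed F -> P (x m) (stays X 0 t F) =
    P x' (stays X 0 t [set z | F (z + (x m - x'))]).
  by move=> cF; rewrite -(stays_translate hX)// addrC subrK.
have near_start e : 0 < e -> \forall m \near \oo, `|x m - x'| < e.
  move=> e0; move/cvgrPdist_lt : hcvg => /(_ e e0).
  by apply: filterS => m; rewrite distrC.
have near_hausdorff e : 0 < e -> \forall m \near \oo,
    (forall p, D m p -> exists2 y, D' y & `|p - y| < e) /\
    (forall p, D' p -> exists2 y, D m y & `|p - y| < e).
  move=> e0; have /cvg_lt_eventually : (0 < e%:E)%E by rewrite lte_fin.
  move=> /(_ _ hH)[n0 H].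
  by exists n0 => // m /= /H; exact: hausdorff_dist_lt.
have fin y U : open U -> P y (stays X 0 t U) \is a fin_num.
  by move=> oU; apply: fin_num_measure; exact: msto.
pose p := fine (P x' (stays X 0 t D')).
have pE : P x' (stays X 0 t D') = p%:E by rewrite /p fineK// fin.
rewrite pE; apply/fine_cvgP; split; first by apply: nearW => m; exact: fin.
apply/cvgrPdist_le => e e0.
have lower : \forall m \near \oo, ((p - e)%:E <= P (x m) (stays X 0 t (D m)))%E.
  have : ((p - e)%:E < P x' (stays X 0 t setT `&` stays X 0 t D'))%E.
    by rewrite setIidr// pE lte_fin; lra.
  move=> /open_ereal_gt' /(inner_stays_cvg hX (lexx 0) ht closedT oD')[n _].
  move=> /(_ n (leqnn n)); rewrite /= setTI; set rho := n.+1%:R^-1 => lt_n.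
  have rho20 : 0 < rho / 2 by rewrite divr_gt0// invr_gt0.
  have [dl dl0 fills] := cone_property_fills (d := d) heps hcos rho20.
  near=> m.
  have xm : `|x m - x'| < rho / 2 by near: m; exact: near_start.
  have sub : inner_part D' (rho / 2) `<=` D m.
    apply: fills => //; first by have [] := hD m.
    suff : (forall p, D m p -> exists2 y, D' y & `|p - y| < dl) /\
      (forall p, D' p -> exists2 y, D m y & `|p - y| < dl) by case.
    by near: m; exact: near_hausdorff.
  have cI := @closed_inner_part R d D' (rho / 2).
  apply: (@le_trans _ _ (P (x m) (stays X 0 t (inner_part D' (rho / 2))))).
    rewrite translate//; apply: le_trans (ltW lt_n) _.
    apply: le_measure; rewrite ?inE.
    - by apply: mst; exact: closed_inner_part.
    - by apply: mst; exact: closed_translate.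
    - apply: staysS => z /inner_part_move; apply.
      by rewrite addrC addKr ltW.
  by apply: le_measure; rewrite ?inE; [exact: mst|exact: msto|exact: staysS].
have upper : \forall m \near \oo, (P (x m) (stays X 0 t (D m)) <= (p + e)%:E)%E.
  have : (P x' (stays X 0 t (closure D')) < (p + e)%:E)%E.
    rewrite (stays_closure_cone_property hX heps hcos hD')// pE lte_fin; lra.
  move=> /(cvg_lt_eventually (thickening_stays_cvg hX (y := x') (D := D') ht))[n].
  move=> /(_ n (leqnn n)) lt_n.
  pose dl : R := n.+1%:R^-1 / 3.
  have dl0 : 0 < dl by rewrite divr_gt0// invr_gt0.
  near=> m.
  have xm : `|x m - x'| < dl by near: m; exact: near_start.
  have sub : D m `<=` thickening D' dl.
    suff [H _] : (forall p, D m p -> exists2 y, D' y & `|p - y| < dl) /\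
      (forall p, D' p -> exists2 y, D m y & `|p - y| < dl).
      by move=> z /H zD'; exact: subset_closure.
    by near: m; exact: near_hausdorff.
  have cT := @closed_thickening R d D' dl.
  apply: (@le_trans _ _ (P (x m) (stays X 0 t (thickening D' dl)))).
    by apply: le_measure; rewrite ?inE; [exact: msto|exact: mst|exact: staysS].
  rewrite translate//; apply: le_trans (ltW lt_n).
  apply: le_measure; rewrite ?inE.
  - by apply: mst; exact: closed_translate.
  - by apply: mst; exact: closed_thickening.
  - apply: staysS => z /(thickening_move dl0 xm).
    by rewrite /dl mulrC divfK// pnatr_eq0.
near=> m; have Pm : P (x m) (stays X 0 t (D m)) =
    (fine (P (x m) (stays X 0 t (D m))))%:E by rewrite fineK// fin.
have : ((p - e)%:E <= P (x m) (stays X 0 t (D m)))%E by near: m.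
have : (P (x m) (stays X 0 t (D m)) <= (p + e)%:E)%E by near: m.
by rewrite Pm !lee_fin /= ler_norml => ? ?; apply/andP; split; lra.
Unshelve. all: by end_near.
Qed.
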